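(* Let $\mathfrak{g}$ be a real finite-dimensional Lie algebra with Levi decomposition $\mathfrak{g}=(\mathfrak{k}\times\mathfrak{s})\ltimes\mathfrak{r}$, where $\mathfrak{r}$ is the solvable radical, $\mathfrak{k}$ is semisimple of compact type and $\mathfrak{s}$ is semisimple without factors of compact type, and put $\mathfrak{g}_{\rm s}=\mathfrak{s}\ltimes\mathfrak{r}$. Let $\langle\cdot,\cdot\rangle$ be a nil-invariant symmetric bilinear form on $\mathfrak{g}$ and let $\langle\cdot,\cdot\rangle_{\mathfrak{g}_{\rm s}}$ be its restriction to $\mathfrak{g}_{\rm s}$. Then: (1) $\langle\cdot,\cdot\rangle_{\mathfrak{g}_{\rm s}}$ is invariant by the adjoint action of $\mathfrak{g}$ on $\mathfrak{g}_{\rm s}$, that is, $\langle[X,Y],Z\rangle=-\langle Y,[X,Z]\rangle$ for all $X\in\mathfrak{g}$ and $Y,Z\in\mathfrak{g}_{\rm s}$. (2) $\langle\cdot,\cdot\rangle$ is invariant by $\mathfrak{g}_{\rm s}$, that is, $\langle[X,Y],Z\rangle=-\langle Y,[X,Z]\rangle$ for all $X\in\mathfrak{g}_{\rm s}$ and $Y,Z\in\mathfrak{g}$.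
   Context: Nil-invariance: let $\overline{\mathrm{Inn}(\mathfrak{g})}^{\rm z}$ be the Zariski closure of the adjoint group $\mathrm{Inn}(\mathfrak{g})$ in $\mathrm{Aut}(\mathfrak{g})$. A symmetric bilinear form $\langle\cdot,\cdot\rangle$ on $\mathfrak{g}$ (possibly degenerate) is nil-invariant if $\langle\varphi X_1,X_2\rangle=-\langle X_1,\varphi X_2\rangle$ for all $X_1,X_2\in\mathfrak{g}$ and all nilpotent elements $\varphi$ of the Lie algebra of $\overline{\mathrm{Inn}(\mathfrak{g})}^{\rm z}$. Equivalently, every nilpotent operator in the smallest algebraic Lie subalgebra of $\mathfrak{gl}(\mathfrak{g})$ containing $\mathrm{ad}(\mathfrak{g})$ is skew for $\langle\cdot,\cdot\rangle$. A semisimple Lie algebra is of compact type if its Killing form is definite. The factors $\mathfrak{k}$, $\mathfrak{s}$, $\mathfrak{r}$ may be zero. *)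

(* Defs.v *)
From HB Require Import structures.
From mathcomp Require Import all_boot all_order all_algebra.
From mathcomp Require Import all_classical all_reals all_analysis.
From mathcomp Require mpoly.

Set Implicit Arguments.
Unset Strict Implicit.
Unset Printing Implicit Defensive.

Import Order.TTheory GRing.Theory Num.Theory.
Import numFieldNormedType.Exports.

Local Open Scope classical_set_scope.
Local Open Scope ring_scope.

Section LieAlgebra.
Variables (R : realType) (g : vectType R) (br : {bilinear g -> g -> g}).
Implicit Types (U V I J h k s r : {vspace g}) (x y z : g) (f : 'End(g)).

Record lie_bracket : Prop := LieBracket {
  lie_alt : forall x, br x x = 0;
  lie_jacobi : forall x y z,
    br x (br y z) + br y (br z x) + br z (br x y) = 0 }.

Definition ad x : 'End(g) := linfun (br x).

Definition subalgebra h : Prop := {in h &, forall x y, br x y \in h}.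

(* I is an ideal of the subalgebra h, not necessarily of g *)
Definition ideal_of h I : Prop :=
  (I <= h)%VS /\ (forall x y, x \in h -> y \in I -> br x y \in I).

(* By bilinearity, brackets of basis vectors span [U, V] *)
Definition brspace U V : {vspace g} :=
  <<[seq br x y | x <- vbasis U, y <- vbasis V]>>%VS.

Definition derived_series h (n : nat) : {vspace g} :=
  iter n (fun U => brspace U U) h.

Definition solvable_alg h : Prop := exists n, derived_series h n = 0%VS.

(* r is the largest solvable ideal of h *)
Record is_radical h r : Prop := IsRadical {
  radical_ideal : ideal_of h r;
  radical_solvable : solvable_alg r;
  radical_max : forall I, ideal_of h I -> solvable_alg I -> (I <= r)%VS }.

Definition semisimple h : Prop := subalgebra h /\ is_radical h 0%VS.

(* Killing form of the subalgebra h itself: the trace of ad x \o ad y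
   restricted to h (meaningful for x, y in h) *)
Definition killing h x y : R :=
  \sum_(i < \dim h) coord (vbasis h) i (br x (br y (vbasis h)`_i)).

Definition killing_definite h : Prop :=
  (forall x, x \in h -> x != 0 -> 0 < killing h x x) \/
  (forall x, x \in h -> x != 0 -> killing h x x < 0).

Definition compact_type h : Prop := semisimple h /\ killing_definite h.

(* h = I \times J as Lie algebras, for some J *)
Definition factor_of h I : Prop :=
  exists J, [/\ ideal_of h I, ideal_of h J, (I + J)%VS = h
                & (I :&: J)%VS = 0%VS].

Definition no_compact_factor h : Prop :=
  forall I, factor_of h I -> compact_type I -> I = 0%VS.

(* g = (k \times s) \ltimes r *)
Record levi_decomposition k s r : Prop := LeviDecomposition {
  levi_radical : is_radical fullv r;
  levi_compact : compact_type k;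
  levi_noncompact : semisimple s /\ no_compact_factor s;
  levi_comm : forall x y, x \in k -> y \in s -> br x y = 0;
  levi_sum : (k + s + r)%VS = fullv;
  levi_direct : directv (k + s + r) }.

Definition expmx n (A : 'M[R]_n) : 'M[R]_n :=
  limn (series (fun i => (i`!%:R)^-1 *: A ^+ i)).

(* mxof acts on row vectors, hence reverses composition; this does not affect
   the power series of a single endomorphism *)
Definition mxend f : 'M[R]_(\dim {:g}) :=
  passmx.mxof (vbasis {:g}) (vbasis {:g}) f.

Definition expend f : 'End(g) :=
  passmx.hommx (vbasis {:g}) (vbasis {:g}) (expmx (mxend f)).

Definition Aut : set 'End(g) :=
  [set f | lker f = 0%VS /\ forall x y, f (br x y) = br (f x) (f y)].

Inductive Inn : set 'End(g) :=
| Inn_exp x : Inn (expend (ad x))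
| Inn_id : Inn \1%VF
| Inn_comp f1 f2 : Inn f1 -> Inn f2 -> Inn (f1 \o f2)%VF
| Inn_inv f : Inn f -> Inn (f^-1)%VF.

Definition polyfun (p : mpoly.mpoly (\dim {:g} * \dim {:g}) R) f : R :=
  mpoly.meval (fun i => mxvec (mxend f) 0 i) p.

(* On invertible endomorphisms the regular functions are p / det ^ m, with
   the same zeros as the polynomial functions p *)
Definition zariski_closure (G S : set 'End(g)) : set 'End(g) :=
  [set f | G f /\ forall p,
     (forall f', S f' -> polyfun p f' = 0) -> polyfun p f = 0].

(* Lie algebra of a closed subgroup G of GL(g) *)
Definition lie_of (G : set 'End(g)) : set 'End(g) :=
  [set f | forall t : R, G (expend (t *: f))].

Definition nilpotent_end f : Prop := exists n, forall x, iter n f x = 0.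

Definition nil_invariant (form : g -> g -> R) : Prop :=
  forall f, lie_of (zariski_closure Aut Inn) f -> nilpotent_end f ->
  forall x y, form (f x) y = - form x (f y).

End LieAlgebra.

(* Main.v *)
(* Let [Inv] be the space of all [x] such that [ad x] is skew for the form. If [Y]
   and [Z] lie in [Inv] then, for every [X], both [<[X,Y],Z>] and [-<Y,[X,Z]>] equal
   [<X,[Y,Z]>]; hence (1) follows from (2), which says that [s] and [r] lie in [Inv].

   The nilpotent Jordan part [N] of every [ad x] is skew: [exp (t N)] lies in the
   Zariski closure of [Inn]. Indeed, if a polynomial [p] vanishes at [exp (t ad x)]
   for all [t], then all iterates at [1] of the derivation of the polynomial ring
   that extends [ad x] vanish on [p], and so does every polynomial in this
   derivation; the flow of its nilpotent part is one.

   For [r] one goes down the derived series. If [x] is in a term [p] and [[p,p]] is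
   contained in [Inv], then the Fitting 1-component [g1] of [ad x] is contained in
   [(ad x)^2 g], hence in [Inv]; this forces [<x,g1> = 0] and [<g1,g0> = 0], and on
   the Fitting null component [g0] the operator [ad x] is its nilpotent part.

   For [s], let [V] be the span of the elements of [s] that are ad-nilpotent on [g],
   an ideal contained in [Inv], and [h] its orthogonal in [s] for the trace form
   of [g]. By Cartan's criterion [s] is the direct sum of [h] and [V]. The
   derivation acting by the real parts of the eigenvalues of [ad x], for [x] in
   [h], has no nonzero eigenvalue on [h], since its eigenvectors would be
   ad-nilpotent. So the Killing form of [h] is negative semidefinite, hence
   definite by Engel's theorem, and [h = 0]. *)

Require Import Defs.
From HB Require Import structures.
From mathcomp Require Import all_boot all_order all_algebra.
From mathcomp Require Import all_classical all_reals all_analysis.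
From mathcomp Require Import ring lra complex.
From mathcomp Require mpoly.
(* The notations of mpoly clash with those of MathComp-Analysis. *)
Import -(notations) mpoly.

Set Implicit Arguments.
Unset Strict Implicit.
Unset Printing Implicit Defensive.

Import Order.TTheory GRing.Theory Num.Theory.
Import passmx.
Local Open Scope ring_scope.
Local Notation mapC := (map_poly (real_complex _)).

(** * Polynomials of a linear operator *)

Section PolyAction.
Variables (F : fieldType) (V : lmodType F) (T : {linear V -> V}).
Implicit Types (f g : {poly F}) (v w : V) (c : F).

(** The vector [f(T) v]. The module is arbitrary since [T] will also be a derivation of a polynomial
    ring, which has infinite dimension. *)
Definition pact f v : V := \sum_(i < size f) f`_i *: iter i T v.

Lemma pact_wide n f v : (size f <= n)%N ->
  pact f v = \sum_(i < n) f`_i *: iter i T v.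
Proof.
move=> le_fn; rewrite /pact (big_ord_widen n (fun i => f`_i *: iter i T v) le_fn).
rewrite big_mkcond; apply: eq_bigr => i _; case: ltnP => // le_fi.
by rewrite nth_default ?scale0r.
Qed.

Lemma iterT_linear i : linear (iter i T).
Proof. by elim: i => [|i IHi] a u v //=; rewrite IHi linearP. Qed.

Lemma pact_is_linear f : linear (pact f).
Proof.
move=> a u v; rewrite /pact scaler_sumr -big_split /=; apply: eq_bigr => i _.
by rewrite iterT_linear scalerDr !scalerA mulrC.
Qed.
HB.instance Definition _ f := GRing.isSemilinear.Build F V V _ (pact f)
  (GRing.semilinear_linear (@pact_is_linear f)).

Lemma pactD f g v : pact (f + g) v = pact f v + pact g v.
Proof.
pose n := maxn (size f) (size g).
rewrite (@pact_wide n (f + g)) ?size_polyD//.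
rewrite (@pact_wide n f) ?leq_maxl// (@pact_wide n g) ?leq_maxr// -big_split.
by apply: eq_bigr => i _; rewrite coefD scalerDl.
Qed.

Lemma pactZ c f v : pact (c *: f) v = c *: pact f v.
Proof.
rewrite (@pact_wide (size f)) ?size_scale_leq// /pact scaler_sumr.
by apply: eq_bigr => i _; rewrite coefZ scalerA.
Qed.

Lemma pact0 v : pact 0 v = 0.
Proof. by rewrite /pact size_poly0 big_ord0. Qed.

Lemma pactN f v : pact (- f) v = - pact f v.
Proof. by rewrite -[- f]scaleN1r pactZ scaleN1r. Qed.

Lemma pactB f g v : pact (f - g) v = pact f v - pact g v.
Proof. by rewrite pactD pactN. Qed.

Lemma pactC c v : pact c%:P v = c *: v.
Proof.
by rewrite (@pact_wide 1) ?size_polyC_leq1// big_ord_recl big_ord0 coefC addr0.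
Qed.

Lemma pact1 v : pact 1 v = v.
Proof. by rewrite pactC scale1r. Qed.

Lemma pactMX f v : pact (f * 'X) v = pact f (T v).
Proof.
rewrite (@pact_wide (size f).+1); last first.
  by rewrite (leq_trans (size_polyMleq _ _))// size_polyX addn2.
rewrite big_ord_recl coefMX scale0r add0r; apply: eq_bigr => i _.
by rewrite lift0 coefMX /= -iterS iterSr.
Qed.

Lemma pactX v : pact 'X v = T v.
Proof. by rewrite -[X in pact X]mul1r pactMX pact1. Qed.

Lemma pactT f v : pact f (T v) = T (pact f v).
Proof.
rewrite /pact linear_sum; apply: eq_bigr => i _.
by rewrite linearZ /= -iterS iterSr.
Qed.

Lemma pactM f g v : pact (f * g) v = pact f (pact g v).
Proof.
elim/poly_ind: f => [|f c IHf] in v *; first by rewrite mul0r !pact0.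
rewrite mulrDl !pactD mulrAC !pactMX IHf pactT mul_polyC pactZ pactC.
by rewrite pactT.
Qed.

Lemma pactXn i v : pact ('X^i) v = iter i T v.
Proof. by elim: i => [|i IHi] in v *; rewrite ?pact1// exprS pactM IHi pactX. Qed.

Lemma pactXsubC c v : pact ('X - c%:P) v = T v - c *: v.
Proof. by rewrite pactB pactX pactC. Qed.

Lemma pact_stable (P : V -> Prop) f :
  P 0 -> (forall u v, P u -> P v -> P (u + v)) -> (forall c v, P v -> P (c *: v)) ->
  (forall v, P v -> P (T v)) -> forall v, P v -> P (pact f v).
Proof.
move=> P0 PD PZ PT v Pv; rewrite /pact; elim/big_ind: _ => // i _; apply: PZ.
by elim: (i : nat) => //= j; apply: PT.
Qed.

Lemma pact_dvdp f g v : g %| f -> pact g v = 0 -> pact f v = 0.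
Proof. by move=> /dvdpP[q ->] gv0; rewrite pactM gv0 linear0. Qed.

Lemma pact_congr f g h v : h %| f - g -> pact h v = 0 -> pact f v = pact g v.
Proof.
by move=> hfg hv; apply/eqP; rewrite -subr_eq0 -pactB (pact_dvdp hfg hv).
Qed.

End PolyAction.

Lemma pact_intertwine (F : fieldType) (V W : lmodType F) (T : {linear V -> V})
    (U : {linear W -> W}) (phi : {linear V -> W}) (f : {poly F}) v :
  (forall x, phi (T x) = U (phi x)) -> phi (pact T f v) = pact U f (phi v).
Proof.
move=> phiT; rewrite /pact linear_sum; apply: eq_bigr => i _; rewrite linearZ /=.
by congr (_ *: _); elim: (i : nat) => //= j <-.
Qed.

(** * Chinese remainders and primary decomposition *)

Section Interpolation.
Variable F : fieldType.
Implicit Types (s : seq F) (f : {poly F}) (K : nat).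

(** One common exponent [K] replaces the individual multiplicities; for large [K] this is a multiple
    of the characteristic polynomial. *)
Definition primes_at s K : {poly F} := \prod_(a <- s) ('X - a%:P) ^+ K.

Lemma coprimep_primes_at a s K : a \notin s ->
  coprimep (('X - a%:P) ^+ K) (primes_at s K).
Proof.
elim: s => [|b s IHs]; rewrite /primes_at ?big_nil ?coprimep1//.
rewrite inE negb_or => /andP[ab /IHs cs]; rewrite big_cons coprimepMr cs andbT.
by rewrite coprimep_expl// coprimep_expr// coprimep_XsubC root_XsubC eq_sym.
Qed.

Lemma primes_at_bezout a s K : a \notin s ->
  exists u v, u * ('X - a%:P) ^+ K + v * primes_at s K = 1.
Proof.
move=> /(coprimep_primes_at K)/Bezout_eq1_coprimepP[[u v] /= e].
by exists u, v.
Qed.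

Lemma dvdp_primes_at a s K : a \in s -> ('X - a%:P) ^+ K %| primes_at s K.
Proof.
by move=> as_; rewrite /primes_at (big_rem a as_) /= dvdp_mulr.
Qed.

Lemma crt_poly s K (h : F -> {poly F}) :
  exists f, forall a, a \in s -> ('X - a%:P) ^+ K %| f - h a.
Proof.
elim: s => [|b s [f fP]]; first by exists 0.
have [bs|bs] := boolP (b \in s).
  by exists f => a; rewrite inE => /predU1P[->|]; apply: fP.
have [u [v uv]] := primes_at_bezout K bs.
(* By the Bezout identity the two multipliers are 0 and 1 modulo the power at [b], and 1 and 0
   modulo the powers at [s]. *)
exists (f * (u * ('X - b%:P) ^+ K) + h b * (v * primes_at s K)) => a.
rewrite inE => /predU1P[->|as_].
  set A := (_ ^+ K) in uv *; have -> : v * primes_at s K = 1 - u * A by rewrite -uv; ring.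
  rewrite [X in _ %| X](_ : _ = ((f - h b) * u) * A); last by ring.
  exact: dvdp_mull.
set A := (_ ^+ K) in uv *; have -> : u * A = 1 - v * primes_at s K by rewrite -uv; ring.
rewrite [X in _ %| X](_ : _ = (f - h a) + ((h b - f) * v) * primes_at s K); last by ring.
by rewrite dvdp_add ?fP// dvdp_mull// dvdp_primes_at.
Qed.

Lemma pact_decomp (V : lmodType F) (T : {linear V -> V}) s K v : uniq s ->
  pact T (primes_at s K) v = 0 ->
  exists2 w : F -> V, v = \sum_(a <- s) w a &
    forall a, a \in s -> pact T (('X - a%:P) ^+ K) (w a) = 0.
Proof.
elim: s v => [|b s IHs] v; rewrite /primes_at.
  by rewrite !big_nil pact1 => _ ->; exists (fun=> 0); rewrite ?big_nil.
rewrite /= big_cons -/(primes_at s K) => /andP[bs us] v0.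
have [p [q pq]] := primes_at_bezout K bs.
have [|w ws wP] := IHs (pact T (p * ('X - b%:P) ^+ K) v) us.
  by rewrite -pactM mulrCA [_ * (_ ^+ _)]mulrC pactM v0 linear0.
exists (fun a => if a == b then pact T (q * primes_at s K) v else w a).
  rewrite big_cons eqxx (@eq_big_seq _ _ _ _ _ _ w) -?ws.
    by rewrite -pactD addrC pq pact1.
  by move=> a as_; case: eqP => // eab; rewrite -eab as_ in bs.
move=> a; rewrite inE; case: eqP => [-> _|_ /=]; last exact: wP.
by rewrite -pactM mulrCA pactM v0 linear0.
Qed.

End Interpolation.

(** [T - (a + b)] sends [B u v] to [B ((T - a) u) v + B u ((T - b) v)], so each application lowers
    one of the two exponents. It serves both for Lie brackets and for the product of polynomials. *)
Lemma derivation_weight (F : fieldType) (V : lmodType F) (T : {linear V -> V})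
    (B : V -> V -> V) (a b : F) K L u v :
  (forall u, B u 0 = 0) -> (forall v, B 0 v = 0) ->
  (forall u u' v, B (u + u') v = B u v + B u' v) ->
  (forall u v v', B u (v + v') = B u v + B u v') ->
  (forall c u v, B (c *: u) v = c *: B u v) ->
  (forall c u v, B u (c *: v) = c *: B u v) ->
  (forall u v, T (B u v) = B (T u) v + B u (T v)) ->
  pact T (('X - a%:P) ^+ K) u = 0 -> pact T (('X - b%:P) ^+ L) v = 0 ->
  pact T (('X - (a + b)%:P) ^+ (K + L)) (B u v) = 0.
Proof.
move=> Br0 B0r BDl BDr BZl BZr Tder.
have [m] := ubnP (K + L); elim: m => // m IHm in K L u v *.
case: K => [|K] leKL; first by rewrite expr0 pact1 => -> _; rewrite B0r linear0.
case: L => [|L] in leKL *; first by rewrite expr0 pact1 => _ ->; rewrite Br0 linear0.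
move=> u0 v0; rewrite addSn exprSr pactM.
have -> : pact T ('X - (a + b)%:P) (B u v) =
    B (pact T ('X - a%:P) u) v + B u (pact T ('X - b%:P) v).
  rewrite !pactXsubC Tder BDl BDr -!scaleN1r !BZl !BZr scaleN1r.
  by rewrite scalerDl !scaleN1r opprD addrACA.
have lem : (K + L.+1 < m)%N by rewrite -ltnS -addSn.
rewrite linearD /= IHm//; last by rewrite -pactM -exprSr.
rewrite -addSnnS in lem *; rewrite IHm ?add0r//.
by rewrite -pactM -exprSr.
Qed.

(** * Complexification *)

(** The pair [(u, v)] stands for [u + i v]; the new name carries the [R[i]]-module structure. *)
Definition complexify (V : Type) : Type := (V * V)%type.

Section Complexify.
Variables (R : rcfType) (V : lmodType R).
Local Notation VC := (complexify V).

HB.instance Definition _ := GRing.Zmodule.copy VC (V * V)%type.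

Definition cscale (c : R[i]) (x : VC) : VC :=
  (complex.Re c *: x.1 - complex.Im c *: x.2, complex.Re c *: x.2 + complex.Im c *: x.1).

Lemma cscaleA a b x : cscale a (cscale b x) = cscale (a * b) x.
Proof.
case: a b x => [a a'] [b b'] [u v]; congr (_, _) => /=.
  by rewrite scalerBr scalerDr !scalerA scalerBl scalerDl !opprD
             [- _ - (a' * b') *: _]addrC addrACA.
by rewrite scalerBr scalerDr !scalerA scalerBl scalerDl
           [_ *: u - _]addrC addrACA addrC [_ *: u + _]addrC [_ *: v + _]addrC.
Qed.

Lemma cscale1 : left_id 1 cscale.
Proof. by case=> u v; rewrite /cscale /= !scale1r !scale0r subr0 addr0. Qed.

Lemma cscaleDr : right_distributive cscale +%R.
Proof.
move=> [a a'] [u v] [u' v']; congr (_, _) => /=.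
  by rewrite !scalerDr opprD addrACA.
by rewrite !scalerDr addrACA.
Qed.

Lemma cscaleDl x : {morph cscale^~ x : a b / a + b}.
Proof.
case: x => u v [a a'] [b b']; congr (_, _) => /=.
  by rewrite !scalerDl opprD addrACA.
by rewrite !scalerDl addrACA.
Qed.

HB.instance Definition _ := GRing.Zmodule_isLmodule.Build R[i] VC
  cscaleA cscale1 cscaleDr cscaleDl.

Lemma cscaleE (c : R[i]) (x : VC) : c *: x =
  (complex.Re c *: x.1 - complex.Im c *: x.2, complex.Re c *: x.2 + complex.Im c *: x.1) :> VC.
Proof. by []. Qed.

Variable T : {linear V -> V}.
Definition cmap (x : VC) : VC := (T x.1, T x.2).

Lemma cmap_linear : linear cmap.
Proof.
move=> c [x x'] [y y']; rewrite !cscaleE; congr (_, _) => /=.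
  by rewrite linearD linearB !linearZ.
by rewrite !linearD !linearZ.
Qed.
HB.instance Definition _ := GRing.isSemilinear.Build R[i] VC VC _ cmap
  (GRing.semilinear_linear cmap_linear).

Lemma pact_cmap (f : {poly R}) (x : VC) :
  pact cmap (mapC f) x = (pact T f x.1, pact T f x.2) :> VC.
Proof.
elim/poly_ind: f => [|f c IHf] in x *.
  by rewrite rmorph0 !pact0.
rewrite rmorphD rmorphM /= map_polyX map_polyC /= !pactD !pactMX IHf /= !pactC.
by rewrite cscaleE /= !scale0r subr0 addr0.
Qed.

End Complexify.

(** A solution [g] at the points of [s] and at their conjugates is averaged with its conjugate. The
    coefficients become real, and the congruences survive because [chi] commutes with
    conjugation. *)
Lemma real_crt (R : rcfType) (chi : R[i] -> R[i]) (s : seq R[i]) K :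
  (forall z, chi (conjc z) = conjc (chi z)) ->
  exists f : {poly R}, forall a, a \in s ->
    ('X - a%:P) ^+ K %| mapC f - (chi a)%:P.
Proof.
move=> chiJ.
have [g gP] := crt_poly (s ++ map (@conjc R) s) K (fun a => (chi a)%:P).
pose f := \poly_(i < size g) complex.Re g`_i.
have fE : mapC f = 2^-1 *: (g + map_poly (@conjc R) g).
  apply/polyP => i; rewrite coef_map coef_poly coefZ coefD coef_map /=.
  case: ltnP => [_|le]; last by rewrite nth_default// conjc0 addr0 mulr0.
  by rewrite ReJ_add mulrC.
exists f => a as_; rewrite fE.
have -> : (chi a)%:P = 2^-1 *: ((chi a)%:P + (chi a)%:P).
  by apply/polyP => i; rewrite coefZ coefD; field.
rewrite -scalerBr dvdpZr ?invr_eq0 ?pnatr_eq0// opprD addrACA dvdp_add//.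
  by rewrite gP// mem_cat as_.
have -> : ('X - a%:P) ^+ K = map_poly (@conjc R) (('X - (conjc a)%:P) ^+ K).
  by rewrite rmorphXn rmorphB /= map_polyX map_polyC /= conjcK.
have -> : (chi a)%:P = map_poly (@conjc R) (chi (conjc a))%:P.
  by rewrite map_polyC /= chiJ conjcK.
by rewrite -rmorphB dvdp_map gP// mem_cat map_f ?orbT.
Qed.

Lemma dvdp_prod_primes_at (F : fieldType) (r : seq F) :
  \prod_(z <- r) ('X - z%:P) %| primes_at (undup r) (size r).
Proof.
rewrite -(big_undup_iterop_count _ _ _ _) /primes_at /=.
elim: (undup r) => [|z s IHs]; first by rewrite !big_nil.
rewrite !big_cons dvdp_mul// -[iterop _ _ _ _]/(('X - z%:P) ^+ count_mem z r).
by rewrite dvdp_exp2l ?count_size.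
Qed.

Lemma spectrum (R : rcfType) (p : {poly R}) : p != 0 ->
  exists s K, uniq s /\ mapC p %| primes_at s K.
Proof.
move=> p0; have [r rE] := closed_field_poly_normal (mapC p).
exists (undup r), (size r); split; first exact: undup_uniq.
rewrite rE (dvdp_trans _ (dvdp_prod_primes_at r))// dvdpZl//.
by rewrite lead_coef_eq0 map_poly_eq0.
Qed.

(** * Derivations acting by an additive function of the eigenvalues *)

Section ChiPart.
Variables (R : rcfType) (V : lmodType R) (T : {linear V -> V}).
Variable B : V -> V -> V.
Hypotheses (BDl : forall u u' v, B (u + u') v = B u v + B u' v)
  (BDr : forall u v v', B u (v + v') = B u v + B u v')
  (BZl : forall c u v, B (c *: u) v = c *: B u v)
  (BZr : forall c u v, B u (c *: v) = c *: B u v)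
  (Tder : forall u v, T (B u v) = B (T u) v + B u (T v)).
Local Notation VC := (complexify V).

Definition cbil (x y : VC) : VC :=
  (B x.1 y.1 - B x.2 y.2, B x.1 y.2 + B x.2 y.1).

Let BNl u v : B (- u) v = - B u v.
Proof. by rewrite -scaleN1r BZl scaleN1r. Qed.
Let BNr u v : B u (- v) = - B u v.
Proof. by rewrite -scaleN1r BZr scaleN1r. Qed.
Let B0l v : B 0 v = 0.
Proof. by rewrite -(scale0r v) BZl !scale0r. Qed.
Let B0r v : B v 0 = 0.
Proof. by rewrite -(scale0r v) BZr !scale0r. Qed.

Let cbilDl x x' y : cbil (x + x') y = cbil x y + cbil x' y.
Proof.
by rewrite /cbil /= !BDl; congr (_, _); rewrite /= ?opprD addrACA.
Qed.
Let cbilDr x y y' : cbil x (y + y') = cbil x y + cbil x y'.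
Proof.
by rewrite /cbil /= !BDr; congr (_, _); rewrite /= ?opprD addrACA.
Qed.
Let cbilZl c x y : cbil (c *: x) y = c *: cbil x y.
Proof.
rewrite /cbil !cscaleE; congr (_, _) => /=.
  rewrite !BDl BNl !BZl opprD addrACA scalerBr scalerDr opprD; congr (_ + _).
  by rewrite addrC.
rewrite !BDl BNl !BZl addrACA scalerBr scalerDr; congr (_ + _).
by rewrite addrC.
Qed.
Let cbilZr c x y : cbil x (c *: y) = c *: cbil x y.
Proof.
rewrite /cbil !cscaleE; congr (_, _) => /=.
  by rewrite !BDr BNr !BZr opprD addrACA scalerBr scalerDr opprD.
by rewrite !BDr BNr !BZr addrACA scalerBr scalerDr.
Qed.
Let cbil_der x y : cmap T (cbil x y) = cbil (cmap T x) y + cbil x (cmap T y).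
Proof.
rewrite /cbil /cmap; congr (_, _) => /=.
  by rewrite linearB /= !Tder opprD addrACA.
by rewrite linearD /= !Tder addrACA.
Qed.

(** On the generalized eigenspace of [a], [f(T)] is the scalar [chi a]. The product maps the spaces
    of [a] and [b] into that of [a + b], with exponent [K + K], where [f(T)] is [chi a + chi b].
    Hence the Leibniz rule over the complex numbers, and on the real form by restriction. *)
Lemma chi_derivation (chi : R[i] -> R[i]) (s : seq R[i]) K (f : {poly R}) :
  uniq s -> (forall x, pact (cmap T) (primes_at s K) x = 0) ->
  (forall a b, chi (a + b) = chi a + chi b) ->
  (forall a, a \in s ++ [seq a + b | a <- s, b <- s] ->
     ('X - a%:P) ^+ (K + K) %| mapC f - (chi a)%:P) ->
  forall u v, pact T f (B u v) = B (pact T f u) v + B u (pact T f v).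
Proof.
move=> us sK chiD fP u v.
suff: pact (cmap T) (mapC f) (cbil (u, 0) (v, 0)) =
    cbil (pact (cmap T) (mapC f) (u, 0)) (v, 0) +
    cbil (u, 0) (pact (cmap T) (mapC f) (v, 0)).
  rewrite !pact_cmap /cbil /= !linear0 !B0r !B0l !subr0.
  by case.
have [wu -> wuP] := pact_decomp us (sK (u, 0)).
have [wv -> wvP] := pact_decomp us (sK (v, 0)).
have cbil_suml (I : Type) (r : seq I) (w : I -> VC) y :
    cbil (\sum_(i <- r) w i) y = \sum_(i <- r) cbil (w i) y.
  elim/big_rec2: _ => [|i x1 x2 _ <-]; last by rewrite cbilDl.
  by rewrite /cbil /= !B0l subr0 addr0.
have cbil_sumr (I : Type) (r : seq I) (w : I -> VC) y :
    cbil y (\sum_(i <- r) w i) = \sum_(i <- r) cbil y (w i).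
  elim/big_rec2: _ => [|i x1 x2 _ <-]; last by rewrite cbilDr.
  by rewrite /cbil /= !B0r subr0 addr0.
rewrite [pact _ _ (\sum_(i <- s) wu i)]linear_sum [pact _ _ (\sum_(i <- s) wv i)]linear_sum.
rewrite !cbil_suml linear_sum -big_split /=.
apply: eq_big_seq => a as_; rewrite !cbil_sumr linear_sum -big_split /=.
apply: eq_big_seq => b bs.
have leK : (K <= K + K)%N by rewrite leq_addr.
have act c w : c \in s -> pact (cmap T) (('X - c%:P) ^+ K) w = 0 ->
    pact (cmap T) (mapC f) w = chi c *: w.
  move=> cs w0; rewrite -(pactC (cmap T)); apply: pact_congr w0.
  by apply: dvdp_trans (fP c _); rewrite ?dvdp_exp2l// mem_cat cs.
rewrite (act a (wu a)) ?wuP// (act b (wv b)) ?wvP//.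
rewrite cbilZl cbilZr -scalerDl -chiD -(pactC (cmap T)).
apply: pact_congr (fP _ _) _.
  by rewrite mem_cat allpairs_f ?orbT.
apply: derivation_weight => //; do ?[exact: wuP | exact: wvP].
- by move=> x; rewrite /cbil /= !B0r subr0 addr0.
- by move=> x; rewrite /cbil /= !B0l subr0 addr0.
Qed.

End ChiPart.

(** * The matrix exponential *)

Lemma expr_scalemx (R : comPzRingType) n (t : R) (A : 'M[R]_n) k :
  (t *: A) ^+ k = t ^+ k *: A ^+ k.
Proof.
elim: k => [|k IHk]; first by rewrite !expr0 scale1r.
by rewrite !exprS IHk -scalerA -!mulmxE -scalemxAl -scalemxAr.
Qed.

Lemma is_deriveMR (R : realType) (f g : R -> R) (t df dg : R) :
  is_derive t (1 : R) f df -> is_derive t (1 : R) g dg ->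
  is_derive t (1 : R) (fun x => f x * g x) (df * g t + f t * dg).
Proof.
move=> df_ dg_; have -> : df * g t + f t * dg = f t *: dg + g t *: df.
  by rewrite addrC /GRing.scale /= [df * _]mulrC.
exact: is_deriveM.
Qed.

Section MatrixExponential.
Import numFieldNormedType.Exports.
Local Open Scope classical_set_scope.
Variables (R : realType) (n : nat).
Implicit Types A : 'M[R]_n.

Lemma expr_mx_bound A : exists2 c : R, 0 <= c &
  forall k i j, `|(A ^+ k) i j| <= c ^+ k.
Proof.
(* The sum of the moduli of all entries dominates every column sum. *)
pose c : R := \sum_i \sum_j `|A i j|.
have c0 : 0 <= c by do 2 (apply: sumr_ge0 => ? _).
exists c => // k; elim: k => [|k IHk] i j.
  by rewrite expr0 mxE expr0; case: (i == j); rewrite ?normr1 ?normr0.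
rewrite exprSr mxE (le_trans (ler_norm_sum _ _ _))// exprSr.
apply: (@le_trans _ _ (c ^+ k * \sum_l `|A l j|)).
  rewrite mulr_sumr; apply: ler_sum => l _.
  by rewrite normrM ler_wpM2r.
rewrite ler_wpM2l ?exprn_ge0//; apply: ler_sum => l _.
by rewrite (bigD1 j)//= lerDl sumr_ge0.
Qed.

Lemma is_cvg_pseries_exp_bound (b : nat -> R) (C c t : R) : 0 <= C -> 0 <= c ->
  (forall k, `|b k| <= C * c ^+ k) ->
  cvgn (pseries (fun k => (k`!%:R)^-1 * b k) t).
Proof.
move=> C0 c0 bP; apply: normed_cvg.
apply: (@series_le_cvg _ _ (fun k => C * exp_coeff (c * `|t|) k)) => //.
- by move=> k /=; rewrite normr_ge0.
- by move=> k; rewrite mulr_ge0 ?exp_coeff_ge0// mulr_ge0.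
- move=> k; rewrite /exp_coeff /= !normrM normrX exprMn normfV normr_nat.
  rewrite -mulrA mulrCA [leRHS](_ : _ = k`!%:R^-1 * (C * c ^+ k * `|t| ^+ k)); last by ring.
  by rewrite mulrCA ler_wpM2l ?invr_ge0// ler_wpM2r ?exprn_ge0.
- rewrite (_ : (fun k => _) = C *: exp_coeff (c * `|t|)); last exact/funext.
  exact/is_cvg_seriesZ/is_cvg_series_exp_coeff.
Qed.

Lemma is_cvg_exp_coeff_mx A i j m (t : R) :
  cvgn (pseries (fun k => (k`!%:R)^-1 * (A ^+ (k + m)) i j) t).
Proof.
have [c c0 cP] := expr_mx_bound A.
apply: (@is_cvg_pseries_exp_bound _ (c ^+ m) c); rewrite ?exprn_ge0// => k.
by rewrite -exprD addnC.
Qed.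

Lemma pseries_diffs_exp_coeff_mx A i j m :
  pseries_diffs (fun k => (k`!%:R)^-1 * (A ^+ (k + m)) i j : R) =
  fun k => (k`!%:R)^-1 * (A ^+ (k + m.+1)) i j.
Proof.
apply/funext => k; rewrite /pseries_diffs factS natrM invfM !mulrA addnS addSn.
by rewrite mulfV ?mul1r// pnatr_eq0.
Qed.

Lemma cvg_mx (u : nat -> 'M[R]_n) (M : 'M[R]_n) :
  (forall i j, u k i j @[k --> \oo] --> M i j) -> u @ \oo --> M.
Proof.
move=> uM B [P nP sPB]; suff: \forall k \near \oo, forall i j, P i j (u k i j).
  by apply: filterS => k /sPB.
by do 2 (apply: filter_forall => ?); apply: uM; apply: nP.
Qed.

(** The summand [+ 0] makes this the case [m = 0] of the shifted coefficients, whose termwise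
    derivatives are the case [m = 1]. *)
Definition expcoef A i j k : R := (k`!%:R)^-1 * (A ^+ (k + 0)) i j.

Lemma expmxE A (t : R) i j : expmx (t *: A) i j = limn (pseries (expcoef A i j) t).
Proof.
pose M : 'M[R]_n := \matrix_(i, j) limn (pseries (expcoef A i j) t).
suff -> : expmx (t *: A) = M by rewrite mxE.
apply/cvg_lim; first exact: norm_hausdorff.
apply: cvg_mx => {}i {}j; rewrite mxE.
have : cvgn (pseries (expcoef A i j) t) := @is_cvg_exp_coeff_mx A i j 0 t.
set u := pseries _ _ => cu; set v := fun k => _.
suff -> : v = u by [].
apply/funext => k; rewrite /v /u /pseries /series /= summxE; apply: eq_bigr => l _.
by rewrite mxE expr_scalemx mxE /expcoef addn0 mulrCA mulrC.
Qed.

Lemma is_derive_expmx A (t : R) i j :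
  is_derive t (1 : R) (fun t => expmx (t *: A) i j) ((expmx (t *: A) *m A) i j).
Proof.
rewrite (_ : (fun _ => _) = fun t => limn (pseries (expcoef A i j) t)); last first.
  by apply/funext => x; rewrite expmxE.
have -> : (expmx (t *: A) *m A) i j =
    limn (pseries (pseries_diffs (expcoef A i j)) t).
  rewrite /expcoef pseries_diffs_exp_coeff_mx mxE; apply/esym/cvg_lim => //.
  under eq_bigr do rewrite expmxE.
  rewrite (_ : pseries _ _ =
      (fun k => \sum_(l < n) (pseries (expcoef A i l) t k * A l j))).
    apply: cvg_big => [|l _]; first exact: add_continuous. apply: cvgM; last exact: cvg_cst.
    exact: is_cvg_exp_coeff_mx.
  apply/funext => k; rewrite /pseries /series /=.
  under [RHS]eq_bigr do rewrite mulr_suml.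
  rewrite exchange_big; apply: eq_bigr => l _.
  rewrite addn1 exprSr mxE mulr_sumr mulr_suml; apply: eq_bigr => q _ /=.
  by rewrite /expcoef addn0; ring.
(* Termwise differentiation at [t] requires convergence at a point of larger modulus; [|t| + 1] is
   such a point. *)
apply: (@pseries_snd_diffs _ _ (`|t| + 1)).
- exact: is_cvg_exp_coeff_mx.
- by rewrite pseries_diffs_exp_coeff_mx; apply: is_cvg_exp_coeff_mx.
- by rewrite !pseries_diffs_exp_coeff_mx; apply: is_cvg_exp_coeff_mx.
- by rewrite [ltRHS]ger0_norm ?addr_ge0// ltrDl.
Qed.

Lemma expmx_nilp A K (t : R) : A ^+ K = 0 ->
  expmx (t *: A) = \sum_(k < K) (k`!%:R)^-1 *: (t *: A) ^+ k.
Proof.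
move=> AK; apply/cvg_lim; first exact: norm_hausdorff.
apply: cvg_near_cst; near=> m; rewrite /series /=.
have leKm : (K <= m)%N by near: m; exact: nbhs_infty_ge.
rewrite -(subnKC leKm) /index_iota subn0 iotaD big_cat /= -[X in _ = X]addr0 add0n.
congr (_ + _).
  by have -> : iota 0 K = index_iota 0 K; rewrite ?big_mkord// /index_iota subn0.
rewrite big_seq big1// => k; rewrite mem_iota => /andP[leKk _].
have Ak : A ^+ k = 0 by rewrite -(subnKC leKk) exprD AK mul0r.
by rewrite expr_scalemx Ak !scaler0.
Unshelve. all: by end_near. Qed.

Lemma expmx0 : expmx (0 : 'M[R]_n) = 1%:M.
Proof.
rewrite -[0](scale0r (0 : 'M[R]_n)) (@expmx_nilp 0 1) ?expr1//.
by rewrite big_ord_recl big_ord0 expr0 fact0 invr1 scale1r addr0.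
Qed.

Lemma trmx_expmx A (t : R) : (expmx (t *: A))^T = expmx (t *: A^T).
Proof.
have trX k : (A ^+ k)^T = A^T ^+ k.
  elim: k => [|k IHk]; first by rewrite !expr0 trmx1.
  by rewrite exprS exprSr -!mulmxE trmx_mul IHk.
apply/matrixP => i j; rewrite mxE !expmxE; congr (limn (pseries _ t)).
by apply/funext => k; rewrite /expcoef -trX mxE.
Qed.

(** The entries of [exp(tA) A] are the derivatives of those of [exp(tA)]. Applied to the transpose
    of [A], this gives the same derivatives for [A exp(tA)]. *)
Lemma expmx_comm A (t : R) : expmx (t *: A) *m A = A *m expmx (t *: A).
Proof.
have e (B : 'M[R]_n) i j :
    (expmx (t *: B) *m B) i j = 'D_(1 : R) (fun t : R => expmx (t *: B) i j) t.
  by have [_ ->] := is_derive_expmx B t i j.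
apply/matrixP => i j; rewrite e -[A *m _]trmxK [RHS]mxE trmx_mul.
rewrite trmx_expmx e; congr ('D_(1 : R) _ t).
by apply/funext => x; rewrite -trmx_expmx mxE.
Qed.

Lemma is_derive_mulmx m p (A : R -> 'M[R]_(m, n)) (B : R -> 'M[R]_(n, p))
    (A' : 'M[R]_(m, n)) (B' : 'M[R]_(n, p)) (t : R) :
  (forall i j, is_derive t (1 : R) (fun t => A t i j) (A' i j)) ->
  (forall i j, is_derive t (1 : R) (fun t => B t i j) (B' i j)) ->
  forall i j, is_derive t (1 : R) (fun t => (A t *m B t) i j)
    ((A' *m B t + A t *m B') i j).
Proof.
move=> dA dB i j; rewrite (_ : (fun _ => _) =
    \sum_(l < n) (fun t => A t i l * B t l j)); last first.
  by apply/funext => x; rewrite mxE fct_sumE.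
by rewrite !mxE -big_split; apply: is_derive_sum => l /=; apply: is_deriveMR.
Qed.
Lemma is_derive_ext (f g : R -> R) t d : f = g ->
  is_derive t (1 : R) g d -> is_derive t (1 : R) f d.
Proof. by move=> ->. Qed.

Lemma is_derive_expmxN A (t : R) i j :
  is_derive t (1 : R) (fun t => expmx (t *: - A) i j) ((- A *m expmx (t *: - A)) i j).
Proof. by rewrite -expmx_comm; exact: is_derive_expmx. Qed.

(** The derivative of [W exp(-tA)] is [W A exp(-tA) - W A exp(-tA) = 0]. This is the uniqueness of
    the solution of [W' = W A]. *)
Lemma expmx_const m (W : R -> 'M[R]_(m, n)) A :
  (forall t i j, is_derive t (1 : R) (fun t => W t i j) ((W t *m A) i j)) ->
  forall t, W t *m expmx (t *: - A) = W 0.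
Proof.
move=> dW t; apply/matrixP => i j.
have -> : W 0 = W 0 *m expmx ((0 : R) *: - A) by rewrite scale0r expmx0 mulmx1.
apply: (@is_derive_0_is_cst _ (fun t => (W t *m expmx (t *: - A)) i j) t 0) => x.
have := is_derive_mulmx (dW x) (is_derive_expmxN A x) i j.
by rewrite mulNmx mulmxN -!mulmxA subrr mxE.
Qed.

Lemma expmxK A (t : R) : expmx (t *: A) *m expmx (t *: - A) = 1%:M.
Proof.
rewrite -expmx0 -(scale0r A).
apply: (@expmx_const _ (fun t => expmx (t *: A)) A) => x i j.
exact: is_derive_expmx.
Qed.

Lemma expmx_ode m (W : R -> 'M[R]_(m, n)) A :
  (forall t i j, is_derive t (1 : R) (fun t => W t i j) ((W t *m A) i j)) ->
  forall t, W t = W 0 *m expmx (t *: A).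
Proof.
move=> dW t; rewrite -(expmx_const dW t) -mulmxA.
have := expmxK (- A) t; rewrite opprK => ->.
by rewrite mulmx1.
Qed.
Lemma is_derive_mulmxr m p (A : R -> 'M[R]_(m, n)) (A' : 'M[R]_(m, n))
    (B : 'M[R]_(n, p)) (t : R) :
  (forall i j, is_derive t (1 : R) (fun t => A t i j) (A' i j)) ->
  forall i j, is_derive t (1 : R) (fun t => (A t *m B) i j) ((A' *m B) i j).
Proof.
move=> dA i j; have dB k l : is_derive t (1 : R) (fun=> B k l) ((0 : 'M[R]_(n, p)) k l).
  by have -> : (0 : 'M[R]_(n, p)) k l = 0 by [rewrite mxE]; apply: is_derive_cst.
by have := is_derive_mulmx dA dB i j; rewrite mulmx0 addr0.
Qed.

Lemma is_derive_orbit m (u : 'M[R]_(m, n)) A (t : R) i j :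
  is_derive t (1 : R) (fun t => (u *m expmx (t *: A)) i j)
    ((u *m expmx (t *: A) *m A) i j).
Proof.
have du k l : is_derive t (1 : R) (fun=> u k l) ((0 : 'M[R]_(m, n)) k l).
  by have -> : (0 : 'M[R]_(m, n)) k l = 0 by [rewrite mxE]; apply: is_derive_cst.
have := is_derive_mulmx du (is_derive_expmx A t) i j.
by rewrite mul0mx add0r mulmxA.
Qed.

(** The first hypothesis makes the kernel of [Q] on row vectors stable under [A]. The curve
    [W = u exp(tA) Q] solves [W' = W (A Q)] and starts at 0. *)
Lemma expmx_stable m (u : 'M[R]_(m, n)) A (Q : 'M[R]_n) (t : R) :
  A *m Q = Q *m (A *m Q) -> u *m Q = 0 -> u *m expmx (t *: A) *m Q = 0.
Proof.
move=> AQ uQ.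
have dW (x : R) i j : is_derive x (1 : R) (fun t => (u *m expmx (t *: A) *m Q) i j)
    ((u *m expmx (x *: A) *m Q *m (A *m Q)) i j).
  have := is_derive_mulmxr Q (is_derive_orbit u A x) i j.
  have -> : u *m expmx (x *: A) *m Q *m (A *m Q) = u *m expmx (x *: A) *m A *m Q.
    by rewrite -(mulmxA _ Q) -AQ mulmxA.
  exact.
by rewrite (expmx_ode dW t) scale0r expmx0 mulmx1 uQ mul0mx.
Qed.

Lemma expmx_orbit_derivative m (u : 'M[R]_(m, n)) A (Q : 'M[R]_n) :
  (forall t : R, u *m expmx (t *: A) *m Q = 0) -> u *m A *m Q = 0.
Proof.
move=> uQ; apply/matrixP => i j; rewrite [RHS]mxE.
have := is_derive_mulmxr Q (is_derive_orbit u A 0) i j.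
rewrite scale0r expmx0 mulmx1 => -[_ <-].
rewrite (_ : (fun _ => _) = cst 0); first exact: derive_cst.
by apply/funext => t; rewrite uQ mxE.
Qed.

(** The matrices [B k] are the coordinates of a bilinear product and the hypothesis says that [A] is
    a derivation of it. Both sides, as rows indexed by [k], solve [W' = W A] with the same initial
    value. *)
Lemma expmx_bilinear (B : 'I_n -> 'M[R]_n) A (u v : 'rV[R]_n) (t : R) k :
  (forall (u v : 'rV[R]_n) (k : 'I_n), (u *m A *m B k *m v^T + u *m B k *m (v *m A)^T) 0 0 =
     \sum_l (u *m B l *m v^T) 0 0 * A l k) ->
  (u *m expmx (t *: A) *m B k *m (v *m expmx (t *: A))^T) 0 0 =
  \sum_l (u *m B l *m v^T) 0 0 * expmx (t *: A) l k.
Proof.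
move=> Ader; pose W (t : R) : 'rV[R]_n :=
  \row_k (u *m expmx (t *: A) *m B k *m (v *m expmx (t *: A))^T) 0 0.
have dW (x : R) i j : is_derive x (1 : R) (fun t => W t i j) ((W x *m A) i j).
  apply: (is_derive_ext (g := fun t : R =>
    (u *m expmx (t *: A) *m B j *m (v *m expmx (t *: A))^T) 0 0)).
    by apply/funext => y; rewrite mxE.
  have -> : (W x *m A) i j =
      (u *m expmx (x *: A) *m A *m B j *m (v *m expmx (x *: A))^T +
       u *m expmx (x *: A) *m B j *m (v *m expmx (x *: A) *m A)^T) 0 0.
    by rewrite Ader mxE; apply: eq_bigr => l _; rewrite mxE.
  apply: is_derive_mulmx; first exact/is_derive_mulmxr/is_derive_orbit.
  move=> k' l; rewrite mxE; apply: (is_derive_ext (g := fun t : R =>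
      (v *m expmx (t *: A)) l k')); last exact: is_derive_orbit.
  by apply/funext => y; rewrite mxE.
have := congr1 (fun M : 'rV[R]_n => M 0 k) (expmx_ode dW t).
rewrite /W mxE => ->; rewrite mxE; apply: eq_bigr => l _; rewrite mxE.
by rewrite scale0r expmx0 !mulmx1.
Qed.
End MatrixExponential.

(** * Nilpotent parts and the Zariski closure *)

Lemma mpoly_alg_ind (F : comNzRingType) m (Q : mpoly.mpoly m F -> Prop) :
  (forall c, Q (mpoly.mpolyC m c)) ->
  (forall i, Q (mpoly.mpolyX F (mpoly.mnm1 i))) ->
  (forall p q, Q p -> Q q -> Q (p + q)) ->
  (forall p q, Q p -> Q q -> Q (p * q)) -> forall p, Q p.
Proof.
move=> QC QX QD QM; elim/mpoly.mpolyind => [|c mon p _ _ Qp].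
  by rewrite -(mpoly.mpolyC0 m F); apply: QC.
apply: QD => //; rewrite -mpoly.mul_mpolyC; apply: (QM) => //.
rewrite mpoly.mpolyXE_id; elim/big_ind: _ => [||i _]; last 1 first.
- elim: (mon i) => [|k IHk]; last by rewrite exprS; apply: (QM).
  by rewrite expr0 -mpoly.mpolyC1; apply: (QC).
- by rewrite -mpoly.mpolyC1; apply: (QC).
- exact: QM.
Qed.

Section MatrixPolynomials.
Variables (F : fieldType) (n : nat).
Local Notation mp := (mpoly.mpoly (n * n) F).
Local Notation cst := (@mpoly.mpolyC (n * n) F).
Implicit Types (M N : 'M[F]_n) (p q : mp).

Definition varmx : 'M[mp]_n :=
  \matrix_(i, j) mpoly.mpolyX F (mpoly.mnm1 (mxvec_index i j)).

(* The derivative of [p] along the vector field [X |-> X M], whose flow is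
   [X |-> X exp (t M)]. *)
Definition mpderiv M p : mp :=
  \sum_k mpoly.mderiv k p * mxvec (varmx *m map_mx cst M) 0 k.

Lemma mpderiv_is_linear M : linear (mpderiv M).
Proof.
move=> c p q; rewrite /mpderiv scaler_sumr -big_split; apply: eq_bigr => k _ /=.
by rewrite linearP mulrDl scalerAl.
Qed.
HB.instance Definition _ M := GRing.isSemilinear.Build F mp mp _ (mpderiv M)
  (GRing.semilinear_linear (@mpderiv_is_linear M)).

Lemma mpderivM M p q : mpderiv M (p * q) = mpderiv M p * q + p * mpderiv M q.
Proof.
rewrite /mpderiv mulr_suml mulr_sumr -big_split; apply: eq_bigr => k _ /=.
by rewrite mpoly.mderivM mulrDl mulrAC mulrA.
Qed.

Lemma mpderivC M c : mpderiv M (cst c) = 0.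
Proof. by rewrite /mpderiv big1// => k _; rewrite mpoly.mderivC mul0r. Qed.

Lemma mpderiv_var M i j :
  mpderiv M (varmx i j) = (varmx *m map_mx cst M) i j.
Proof.
rewrite /mpderiv (bigD1 (mxvec_index i j))//= mxvecE mxE big1 => [|k ne].
  rewrite mpoly.mderivX mpoly.mnm1E eqxx scale1r addr0.
  rewrite (_ : mpoly.mnm_sub _ _ = mpoly.mnm0); first by rewrite mpoly.mpolyX0 mul1r.
  by apply/mpoly.mnmP => l; rewrite mpoly.mnmBE subnn mpoly.mnm0E.
by rewrite mpoly.mderivX mpoly.mnm1E eq_sym (negPf ne) scale0r mul0r.
Qed.

Lemma mp_ind (Q : mp -> Prop) : (forall c, Q (cst c)) ->
  (forall i j, Q (varmx i j)) ->
  (forall p q, Q p -> Q q -> Q (p + q)) ->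
  (forall p q, Q p -> Q q -> Q (p * q)) -> forall p, Q p.
Proof.
move=> QC QX; apply: mpoly_alg_ind => // k.
by case/mxvec_indexP: k => i j; have := QX i j; rewrite mxE.
Qed.

(** The linear form [E -> (E c)_i] on matrices. [mpderiv M] acts on these forms as [M] acts on [c],
    which carries eigenvectors of matrices over to polynomials. *)
Definition rowform i (c : 'cV[F]_n) : mp := (varmx *m map_mx cst c) i 0.

Lemma rowform_is_linear i : linear (rowform i).
Proof.
move=> a u v; rewrite /rowform map_mxD mulmxDr mxE; congr (_ + _).
by rewrite map_mxZ -scalemxAr mxE mpoly.mul_mpolyC.
Qed.
HB.instance Definition _ i := GRing.isSemilinear.Build F 'cV[F]_n mp _ (rowform i)
  (GRing.semilinear_linear (@rowform_is_linear i)).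

Lemma rowform_delta i j : rowform i (delta_mx j 0) = varmx i j.
Proof. by rewrite /rowform map_delta_mx -colE mxE. Qed.

Lemma mpderiv_rowform M i c : mpderiv M (rowform i c) = rowform i (M *m c).
Proof.
rewrite [rowform _ (M *m c)]/rowform map_mxM mulmxA [RHS]mxE [rowform _ _]mxE linear_sum.
apply: eq_bigr => k _ /=.
by rewrite mpderivM mpderiv_var mxE [map_mx _ c k 0]mxE mpderivC mulr0 addr0.
Qed.

Lemma mpderiv_comm M N p : M *m N = N *m M ->
  mpderiv M (mpderiv N p) = mpderiv N (mpderiv M p).
Proof.
move=> MN; elim/mp_ind: p => [c|i j|p q IHp IHq|p q IHp IHq].
- by rewrite !mpderivC ?linear0 ?mpderivC.
- by rewrite -rowform_delta !mpderiv_rowform !mulmxA MN.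
- by rewrite !linearD /= IHp IHq.
- rewrite (mpderivM N p q) (mpderivM M p q) !linearD /= (mpderivM M (mpderiv N p)).
  rewrite (mpderivM M p) (mpderivM N (mpderiv M p)) (mpderivM N p) IHp IHq.
  exact: addrACA.
Qed.

Definition evmx (E : 'M[F]_n) p : F := mpoly.meval (fun k => mxvec E 0 k) p.

Lemma evmx_var E i j : evmx E (varmx i j) = E i j.
Proof. by rewrite /evmx mxE mpoly.mevalXU mxvecE. Qed.
Lemma evmxC E c : evmx E (cst c) = c.
Proof. by rewrite /evmx mpoly.mevalC. Qed.
Lemma evmxD E p q : evmx E (p + q) = evmx E p + evmx E q.
Proof. by rewrite /evmx mpoly.mevalD. Qed.
Lemma evmxM E p q : evmx E (p * q) = evmx E p * evmx E q.
Proof. by rewrite /evmx mpoly.mevalM. Qed.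
Lemma evmxZ E a p : evmx E (a *: p) = a * evmx E p.
Proof. by rewrite /evmx mpoly.mevalZ. Qed.
Lemma evmx0 E : evmx E 0 = 0.
Proof. by rewrite /evmx mpoly.meval0. Qed.
Lemma evmx_sum E (I : Type) (r : seq I) (G : I -> mp) :
  evmx E (\sum_(i <- r) G i) = \sum_(i <- r) evmx E (G i).
Proof. exact: (big_morph _ (evmxD E) (evmx0 E)). Qed.

End MatrixPolynomials.

(** * The Jordan decomposition on polynomial functions *)

Section JordanWeights.
Variables (F : numFieldType) (n : nat) (M N : 'M[F]_n) (K0 : nat).
Hypothesis MN : M *m N = N *m M.
Hypothesis NK0 : N ^+ K0 = 0.
Hypothesis weightsM : forall c : 'cV[F]_n, exists (s : seq F) (w : F -> 'cV[F]_n),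
  c = \sum_(a <- s) w a /\ forall a, M *m w a = a *: w a + N *m w a.
Local Notation mp := (mpoly.mpoly (n * n) F).
Local Notation cst := (@mpoly.mpolyC (n * n) F).

(* [mpderiv M] acts on [p] as [a] plus the nilpotent operator [mpderiv N]. *)
Definition weightvec a (p : mp) : Prop :=
  mpderiv M p = a *: p + mpderiv N p /\ exists K, iter K (mpderiv N) p = 0.

Lemma iter_mpderivM K L (p q : mp) : iter K (mpderiv N) p = 0 ->
  iter L (mpderiv N) q = 0 -> iter (K + L) (mpderiv N) (p * q) = 0.
Proof.
move=> p0 q0.
have := @derivation_weight F mp (mpderiv N) *%R 0 0 K L p q.
rewrite addr0 subr0 !pactXn; apply => //.
- exact: mulr0.
- exact: mul0r.
- exact: mulrDl.
- by move=> u v v'; rewrite mulrDr.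
- by move=> c u v; rewrite scalerAl.
- by move=> c u v; rewrite scalerAr.
- exact: mpderivM.
Qed.

Lemma weightvecM a b p q : weightvec a p -> weightvec b q ->
  weightvec (a + b) (p * q).
Proof.
move=> [Mp [K Kp]] [Mq [L Lq]]; split; last first.
  by exists (K + L)%N; apply: iter_mpderivM.
rewrite !mpderivM Mp Mq mulrDl mulrDr scalerDl -!scalerAl -!scalerAr.
by rewrite addrACA.
Qed.

Lemma iter_lin0 (V : lmodType F) (T : {linear V -> V}) k : iter k T 0 = 0.
Proof. by elim: k => //= k ->; rewrite linear0. Qed.

(** Weight vectors are closed under products, so generators suffice: constants have weight 0, and a
    variable is the linear form of a basis column, which [weightsM] decomposes. *)
Lemma mp_weights p : exists2 s : seq (F * mp),
  p = \sum_(x <- s) x.2 & forall x, x \in s -> weightvec x.1 x.2.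
Proof.
elim/mp_ind: p => [c|i j|p q [s -> sP] [s' -> s'P]|p q [s -> sP] [s' -> s'P]].
- exists [:: (0, cst c)] => [|x]; first by rewrite big_seq1.
  rewrite inE => /eqP ->; split; first by rewrite !mpderivC scale0r addr0.
  by exists 1%N; rewrite /= mpderivC.
- have [s [w [ws wP]]] := weightsM (delta_mx j 0).
  exists [seq (a, rowform i (w a)) | a <- s].
    by rewrite big_map -(linear_sum (rowform i)) -ws /= rowform_delta.
  move=> _ /mapP[a _ ->]; split=> /=.
    by rewrite !mpderiv_rowform wP linearD linearZ.
  exists K0; have -> k : iter k (mpderiv N) (rowform i (w a)) = rowform i (N ^+ k *m w a).
    elim: k => [|k /= ->]; first by rewrite expr0 mul1mx.
    by rewrite mpderiv_rowform exprS mulmxA.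
  by rewrite NK0 mul0mx linear0.
- exists (s ++ s') => [|x]; first by rewrite big_cat.
  by rewrite mem_cat => /orP[/sP|/s'P].
- exists [seq (x.1 + y.1, x.2 * y.2) | x <- s, y <- s'].
    rewrite big_allpairs_dep mulr_suml; apply: eq_bigr => x _.
    by rewrite mulr_sumr.
  by move=> _ /allpairsP[[x y] /= [xs ys ->]]; apply: weightvecM; auto.
Qed.

Lemma pact_weightvec a p l : weightvec a p ->
  pact (mpderiv M) (('X - a%:P) ^+ l) p = iter l (mpderiv N) p.
Proof.
move=> [Mp _]; elim: l => [|l IHl]; first by rewrite pact1.
rewrite exprS pactM IHl pactXsubC /=.
have MNl k : mpderiv M (iter k (mpderiv N) p) =
    a *: iter k (mpderiv N) p + iter k.+1 (mpderiv N) p.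
  elim: k => [|k IHk] //=.
  by rewrite mpderiv_comm// IHk linearD linearZ.
by rewrite MNl addrAC subrr add0r.
Qed.

(** This is [exp(tN)], as [N ^+ K0 = 0]; being a finite sum it also makes sense over [R[i]]. *)
Definition expmx_trunc (t : F) : 'M[F]_n :=
  \sum_(l < K0) (l`!%:R)^-1 *: (t *: N) ^+ l.

(** The matrix [exp(X N)] with time as the indeterminate. Below, [phi p] is the polynomial
    [t -> p(exp(tN))], and its derivative comes from [mpderiv N]. *)
Let expX : 'M[{poly F}]_n :=
  \matrix_(i, j) \poly_(l < K0) ((l`!%:R)^-1 * (N ^+ l) i j).

Let coef_expX i j l : (expX i j)`_l = (l`!%:R)^-1 * (N ^+ l) i j.
Proof.
rewrite mxE coef_poly; case: ltnP => // le; have -> : N ^+ l = 0.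
  by rewrite -(subnK le) exprD NK0 mulr0.
by rewrite mxE mulr0.
Qed.

Let phi : mp -> {poly F} := mpoly.mmap polyC (fun k => mxvec expX 0 k).

Let phiD p q : phi (p + q) = phi p + phi q. Proof. exact: rmorphD. Qed.
Let phiM p q : phi (p * q) = phi p * phi q. Proof. exact: rmorphM. Qed.
Let phiC c : phi (cst c) = c%:P. Proof. exact: mpoly.mmapC. Qed.
Let phi_var i j : phi (varmx F n i j) = expX i j.
Proof. by rewrite /phi mxE mpoly.mmapX mpoly.mmap1U mxvecE. Qed.
Let phi_sum (I : Type) (r : seq I) (G : I -> mp) :
  phi (\sum_(i <- r) G i) = \sum_(i <- r) phi (G i).
Proof. exact: rmorph_sum. Qed.

Let phi_deriv p : (phi p)^`() = phi (mpderiv N p).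
Proof.
elim/mp_ind: p => [c|i j|p q IHp IHq|p q IHp IHq].
- by rewrite mpderivC phiC derivC /phi rmorph0.
- rewrite phi_var mpderiv_var [(_ *m _) i j]mxE phi_sum; apply/polyP => l.
  rewrite coef_deriv coef_expX coef_sum exprSr -mulmxE mxE -mulrnAl mulr_sumr.
  apply: eq_bigr => k _; rewrite phiM phi_var [map_mx _ N k j]mxE phiC coefMC.
  rewrite coef_expX -mulr_natl.
  by rewrite factS natrM invfM !mulrA divff ?mul1r ?mulrA ?pnatr_eq0.
- by rewrite linearD /= !phiD derivD IHp IHq.
- by rewrite phiM derivM mpderivM phiD !phiM IHp IHq.
Qed.

Let phi_horner t p : (phi p).[t] = evmx (expmx_trunc t) p.
Proof.
elim/mp_ind: p => [c|i j|p q IHp IHq|p q IHp IHq].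
- by rewrite phiC hornerC evmxC.
- rewrite phi_var evmx_var mxE horner_poly summxE; apply: eq_bigr => l _.
  by rewrite expr_scalemx !mxE; ring.
- by rewrite phiD hornerD evmxD IHp IHq.
- by rewrite phiM hornerM evmxM IHp IHq.
Qed.

Lemma expmx_trunc0 : expmx_trunc 0 = 1%:M.
Proof.
rewrite /expmx_trunc; case: K0 NK0 => [|k] Nk; first by rewrite big_ord0 -Nk.
rewrite big_ord_recl big1 => [|l _]; last first.
  by rewrite scale0r expr0n scaler0.
by rewrite expr0 fact0 invr1 scale1r addr0.
Qed.

(* Taylor's formula for the polynomial function [t |-> p (exp (t N))]. *)
Lemma evmx_expmx_trunc t p K : iter K (mpderiv N) p = 0 ->
  evmx (expmx_trunc t) p =
  \sum_(l < K) (l`!%:R)^-1 * t ^+ l * evmx (1%:M) (iter l (mpderiv N) p).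
Proof.
move=> pK; have phi_derivn l : (phi p)^`(l) = phi (iter l (mpderiv N) p).
  by elim: l => [|l IHl]; rewrite ?derivn0 ?derivnS ?IHl ?phi_deriv.
have sz : (size (phi p) <= K)%N.
  apply/leq_sizeP => i leKi; have : (phi p)^`(K)`_(i - K) = 0.
    by rewrite phi_derivn pK /phi rmorph0 coef0.
  rewrite coef_derivn subnKC// => /eqP; rewrite mulrn_eq0 => /orP[|/eqP//].
  by rewrite -leqn0 leqNgt ffact_gt0 leKi.
rewrite -phi_horner -[t]add0r (nderiv_taylor_wide (mulrC _ _) sz).
apply: eq_bigr => l _; rewrite add0r -expmx_trunc0 -phi_horner -phi_derivn.
rewrite nderivn_def hornerMn -[_ *+ l`!]mulr_natr.
by field; rewrite pnatr_eq0 -lt0n fact_gt0.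
Qed.

(* A polynomial [f] with [f = exp (t (X - a))] to high order at each weight [a]
   satisfies [f(mpderiv M) p = exp (t mpderiv N) p]. *)
Lemma evmx_vanish t p : (forall i, evmx 1%:M (iter i (mpderiv M) p) = 0) ->
  evmx (expmx_trunc t) p = 0.
Proof.
move=> p0; have [s ps sP] := mp_weights p.
have [K KP] : exists K, forall x, x \in s -> iter K (mpderiv N) x.2 = 0.
  elim: s {ps} sP => [|x s IHs] sP; first by exists 0%N.
  have [y ys|K KP] := IHs; first by apply: sP; rewrite inE ys orbT.
  have [_ [L xL]] := sP x (mem_head _ _).
  exists (K + L)%N => y; rewrite inE => /predU1P[->|/KP yK].
    by rewrite iterD xL iter_lin0.
  by rewrite addnC iterD yK iter_lin0.
pose h a : {poly F} := \sum_(l < K) ((l`!%:R)^-1 * t ^+ l) *: ('X - a%:P) ^+ l.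
have [f fP] := crt_poly [seq x.1 | x <- s] K h.
have : evmx 1%:M (pact (mpderiv M) f p) = 0.
  rewrite /pact evmx_sum big1// => i _; rewrite evmxZ p0 mulr0.
  by [].
rewrite ps linear_sum evmx_sum => <-; rewrite evmx_sum.
apply: eq_big_seq => x xs; rewrite (evmx_expmx_trunc t (KP x xs)).
have wx := sP x xs; rewrite /=.
rewrite (pact_congr (g := h x.1) (fP _ (map_f _ xs))); last first.
  by rewrite pact_weightvec ?KP.
rewrite /h.
have pact_sum (G : 'I_K -> {poly F}) :
    pact (mpderiv M) (\sum_l G l) x.2 = \sum_l pact (mpderiv M) (G l) x.2.
  by apply: (big_morph (fun g => pact (mpderiv M) g x.2)) => [g g'|];
     rewrite ?pactD ?pact0.
rewrite pact_sum evmx_sum; apply: eq_bigr => l _.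
by rewrite pactZ evmxZ pact_weightvec.
Qed.
End JordanWeights.

Section PolyMatrix.
Variables (F : fieldType) (n : nat).
Implicit Types (A : 'M[F]_n) (f g : {poly F}).

(* [horner_mx] is only defined for matrices of syntactically positive size. *)
Definition polymx f A : 'M[F]_n := \sum_(i < size f) f`_i *: A ^+ i.

Lemma pact_mulmx m f A (c : 'M[F]_(n, m)) :
  pact (mulmx A) f c = polymx f A *m c.
Proof.
rewrite /pact /polymx mulmx_suml; apply: eq_bigr => i _; rewrite -scalemxAl.
congr (_ *: _); elim: (i : nat) => [|k IHk] /=; first by rewrite expr0 mul1mx.
by rewrite IHk exprS mulmxA.
Qed.

Lemma polymx_pact f A : polymx f A = pact (mulmx A) f 1%:M.
Proof. by rewrite pact_mulmx mulmx1. Qed.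

Lemma pact_mulmxr m f A (u : 'M[F]_(m, n)) :
  pact (mulmxr A) f u = u *m polymx f A.
Proof.
rewrite /pact /polymx mulmx_sumr; apply: eq_bigr => i _; rewrite -scalemxAr.
congr (_ *: _); elim: (i : nat) => [|k IHk] /=; first by rewrite expr0 mulmx1.
by rewrite IHk exprSr -mulmxA.
Qed.

Lemma polymx_comm f A : A *m polymx f A = polymx f A *m A.
Proof.
by rewrite [in LHS]polymx_pact -(pactT (mulmx A)) pact_mulmx /= mulmx1.
Qed.

Lemma polymxM f g A : polymx (f * g) A = polymx f A *m polymx g A.
Proof. by rewrite [in LHS]polymx_pact pactM pact_mulmx -polymx_pact. Qed.

Lemma polymx_horner m (A : 'M[F]_m.+1) (f : {poly F}) :
  \sum_(i < size f) f`_i *: A ^+ i = horner_mx A f.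
Proof.
rewrite -[f in RHS]coefK poly_def linear_sum; apply: eq_bigr => i _.
by rewrite linearZ /= rmorphXn /= horner_mx_X.
Qed.

Lemma polymx_char_poly A : polymx (char_poly A) A = 0.
Proof.
rewrite /polymx; case: n A => [|m] A; first exact: flatmx0.
by rewrite polymx_horner Cayley_Hamilton.
Qed.

End PolyMatrix.

Lemma map_mxX (F G : fieldType) (h : {rmorphism F -> G}) n (A : 'M[F]_n) k :
  map_mx h (A ^+ k) = map_mx h A ^+ k.
Proof.
elim: k => [|k IHk]; first by rewrite !expr0 map_scalar_mx rmorph1.
by rewrite !exprS -IHk -!mulmxE map_mxM.
Qed.

Lemma map_polymx (F G : fieldType) (h : {rmorphism F -> G}) n (f : {poly F}) (A : 'M[F]_n) :
  map_mx h (polymx f A) = polymx (map_poly h f) (map_mx h A).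
Proof.
rewrite /polymx size_map_poly map_mx_sum; apply: eq_bigr => i _.
by rewrite map_mxZ coef_map map_mxX.
Qed.

Section Transfer.
Variables (F G : fieldType) (h : {rmorphism F -> G}) (n : nat).
Local Notation mph := (mpoly.map_mpoly h).

Lemma map_varmx i j : mph (varmx F n i j) = varmx G n i j.
Proof. by rewrite !mxE mpoly.map_mpolyX. Qed.

Lemma map_mpderiv (M : 'M[F]_n) p : mph (mpderiv M p) = mpderiv (map_mx h M) (mph p).
Proof.
elim/mp_ind: p => [c|i j|p q IHp IHq|p q IHp IHq].
- by rewrite mpderivC rmorph0 mpoly.map_mpolyC mpderivC.
- rewrite map_varmx !mpderiv_var !mxE rmorph_sum; apply: eq_bigr => k _ /=.
  by rewrite rmorphM /= map_varmx [map_mx _ M k j]mxE mpoly.map_mpolyC !mxE.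
- by rewrite !(linearD, rmorphD) /= IHp IHq.
- by rewrite mpderivM rmorphD !rmorphM /= mpderivM IHp IHq.
Qed.

Lemma map_iter_mpderiv (M : 'M[F]_n) p i :
  mph (iter i (mpderiv M) p) = iter i (mpderiv (map_mx h M)) (mph p).
Proof. by elim: i => [//|i IHi]; rewrite !iterS map_mpderiv IHi. Qed.

Lemma map_evmx (E : 'M[F]_n) p : h (evmx E p) = evmx (map_mx h E) (mph p).
Proof.
elim/mp_ind: p => [c|i j|p q IHp IHq|p q IHp IHq].
- by rewrite mpoly.map_mpolyC !evmxC.
- by rewrite map_varmx !evmx_var mxE.
- by rewrite rmorphD !evmxD rmorphD IHp IHq.
- by rewrite rmorphM !evmxM rmorphM IHp IHq.
Qed.

End Transfer.

Section ZariskiNilpotent.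
Import numFieldNormedType.Exports.
Variables (R : realType) (n : nat).
Implicit Types A : 'M[R]_n.
Local Notation toC := (real_complex R).

Lemma is_derive_evmx A p (t : R) :
  is_derive t (1 : R) (fun t => evmx (expmx (t *: A)) p)
    (evmx (expmx (t *: A)) (mpderiv A p)).
Proof.
elim/mp_ind: p => [c|i j|p q IHp IHq|p q IHp IHq].
- rewrite mpderivC evmx0; apply: (is_derive_ext (g := cst c)).
    by apply/funext => x; rewrite evmxC.
- apply: (is_derive_ext (g := fun t => expmx (t *: A) i j)).
    by apply/funext => x; rewrite evmx_var.
  rewrite mpderiv_var mxE evmx_sum.
  have -> : \sum_k evmx (expmx (t *: A))
      (varmx R n i k * map_mx (@mpoly.mpolyC (n * n) R) A k j) =
      (expmx (t *: A) *m A) i j.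
    by rewrite mxE; apply: eq_bigr => k _; rewrite evmxM evmx_var mxE evmxC.
  exact: is_derive_expmx.
- rewrite linearD evmxD.
  apply: (is_derive_ext (g := (fun t => evmx (expmx (t *: A)) p) +
      (fun t => evmx (expmx (t *: A)) q))).
    by apply/funext => x; rewrite evmxD.
- rewrite mpderivM evmxD !evmxM.
  apply: (is_derive_ext (g := (fun t => evmx (expmx (t *: A)) p *
      evmx (expmx (t *: A)) q))).
    by apply/funext => x; rewrite evmxM.
  exact: is_deriveMR.
Qed.

Lemma evmx_expmx_derivatives A p : (forall t : R, evmx (expmx (t *: A)) p = 0) ->
  forall i, evmx 1%:M (iter i (mpderiv A) p) = 0.
Proof.
move=> p0; have step q : (forall t : R, evmx (expmx (t *: A)) q = 0) ->
    forall t : R, evmx (expmx (t *: A)) (mpderiv A q) = 0.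
  move=> q0 t; have [_ <-] := is_derive_evmx A q t.
  rewrite (_ : (fun _ => _) = cst 0); first exact: derive_cst.
  exact/funext.
move=> i; have it : forall t : R, evmx (expmx (t *: A)) (iter i (mpderiv A) p) = 0.
  by elim: i => //= i; apply: step.
by rewrite -expmx0 -(scale0r A).
Qed.

(* [f(A)] is the semisimple part of [A] and [N] its nilpotent part. *)
Lemma zariski_nilpotent_part A s K (f : {poly R}) : uniq s ->
  polymx (primes_at s K) (map_mx toC A) = 0 ->
  (forall a, a \in s -> ('X - a%:P) ^+ K %| mapC f - a%:P) ->
  let N := A - polymx f A in
  N ^+ K = 0 /\
  forall p, (forall t : R, evmx (expmx (t *: A)) p = 0) ->
  forall t : R, evmx (expmx (t *: N)) p = 0.
Proof.
move=> us sK fP N.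
have NC : map_mx toC N = map_mx toC A - polymx (mapC f) (map_mx toC A).
  by rewrite map_mxB map_polymx.
have AN : A *m N = N *m A by rewrite mulmxBr mulmxBl polymx_comm.
have weights (c : 'cV[R[i]]_n) : exists w : R[i] -> 'cV[R[i]]_n,
    [/\ c = \sum_(a <- s) w a,
     forall a, map_mx toC A *m w a = a *: w a + map_mx toC N *m w a &
     forall a, (map_mx toC N) ^+ K *m w a = 0].
  have [|w cw wP] := @pact_decomp _ _ (mulmx (map_mx toC A)) s K c us.
    by rewrite pact_mulmx sK mul0mx.
  (* Cutting off outside [s] makes the two identities hold for every [a]. *)
  exists (fun a => if a \in s then w a else 0).
  have E a : a \in s -> polymx (mapC f) (map_mx toC A) *m w a = a *: w a.
    move=> as_; rewrite -pact_mulmx -(pactC (mulmx (map_mx toC A))).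
    exact: pact_congr (fP a as_) (wP a as_).
  split.
  - by rewrite cw; apply: eq_big_seq => a ->.
  - move=> a; case: ifP => as_; last by rewrite !mulmx0 scaler0 addr0.
    by rewrite NC mulmxBl E// addrC subrK.
  (* On [w a] the matrix [N] acts as [A - a], whose [K]-th power kills [w a]. *)
  - move=> a; case: ifP => as_; last by rewrite mulmx0.
    rewrite -(wP a as_); have := E a as_; elim: (K) (w a) => [|k IHk] u fu.
      by rewrite !expr0 mul1mx pact1.
    rewrite exprSr -mulmxE -mulmxA exprSr pactM pactXsubC /= -IHk.
      by rewrite NC mulmxBl fu.
    by rewrite mulmxBr mulmxA -polymx_comm -mulmxA fu -!scalemxAr fu scalerBr.
have NK : N ^+ K = 0.
  apply: (map_mx_inj (f := toC)); rewrite map_mx0 -[LHS]mulmx1.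
  apply/matrixP => i j; have [w [jw _ wP]] := weights (delta_mx j 0).
  rewrite map_mxX; transitivity ((map_mx toC N ^+ K *m delta_mx j 0) i (0 : 'I_1)).
    by rewrite mulmx1 -colE [RHS]mxE.
  rewrite jw mulmx_sumr summxE big1 ?mxE// => a _.
  by rewrite wP mxE.
split; first exact: NK.
move=> p p0 t; apply: (@complexI R); rewrite rmorph0 map_evmx.
have -> : map_mx toC (expmx (t *: N)) = expmx_trunc (map_mx toC N) K (toC t).
  rewrite (expmx_nilp _ NK) /expmx_trunc map_mx_sum; apply: eq_bigr => l _.
  by rewrite map_mxZ map_mxX map_mxZ fmorphV rmorph_nat.
apply: (@evmx_vanish _ n (map_mx toC A)).
- by rewrite -!map_mxM AN.
- by rewrite -map_mxX NK map_mx0.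
- by move=> c; have [w [cw wP _]] := weights c; exists s, w.
move=> i; rewrite -(map_iter_mpderiv toC A p i).
rewrite -(map_mx1 toC) -map_evmx evmx_expmx_derivatives ?rmorph0//.
Qed.
End ZariskiNilpotent.

(** * Exponentials of derivations *)

Section Coordinates.
Import numFieldNormedType.Exports.
Variables (R : realType) (g : vectType R).
Local Notation n := (\dim {:g}).
Implicit Types (f d : 'End(g)) (x y z u v : g).

Definition coords v : 'rV[R]_n := passmx.rVof (vbasis {:g}) v.

Let basis := vbasisP {:g}.

Lemma coords_inj : injective coords.
Proof. exact: can_inj (passmx.rVofK basis). Qed.

Lemma coordsD u v : coords (u + v) = coords u + coords v.
Proof. by rewrite /coords linearD. Qed.
Lemma coords0 : coords 0 = 0.
Proof. by rewrite /coords linear0. Qed.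

Lemma coords_app f v : coords (f v) = coords v *m mxend f.
Proof. exact: passmx.rVof_app. Qed.

Lemma mxendZ a f : mxend (a *: f) = a *: mxend f.
Proof. by rewrite /mxend linearZ. Qed.

Lemma mxend_expend f : mxend (expend f) = expmx (mxend f).
Proof. exact: passmx.hommxK. Qed.

Lemma coords_expend (t : R) f v :
  coords (expend (t *: f) v) = coords v *m expmx (t *: mxend f).
Proof. by rewrite coords_app mxend_expend mxendZ. Qed.

Lemma coords_pact p f v : coords (pact f p v) = coords v *m polymx p (mxend f).
Proof.
rewrite -pact_mulmxr; apply: (pact_intertwine (phi := passmx.rVof (vbasis {:g}))) => w.
exact: coords_app.
Qed.

Lemma expendK f (t : R) v : expend (t *: - f) (expend (t *: f) v) = v.
Proof.
apply: coords_inj; rewrite !coords_expend -mulmxA.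
have -> : mxend (- f) = - mxend f by exact: linearN.
by rewrite expmxK mulmx1.
Qed.

Lemma expendVK f (t : R) v : expend (t *: f) (expend (t *: - f) v) = v.
Proof.
apply: coords_inj; rewrite !coords_expend -mulmxA.
have -> : mxend (- f) = - mxend f by exact: linearN.
move: (coords v) (mxend f) => u A.
by have := expmxK (- A) t; rewrite opprK => ->; rewrite mulmx1.
Qed.

(* [off U v = 0] is the equation of [U]. *)
Definition off (U : {vspace g}) : 'End(g) := (\1 - projv U)%VF.

Lemma offE U v : off U v = v - projv U v.
Proof. by rewrite /off add_lfunE opp_lfunE id_lfunE. Qed.

Lemma off_eq0 U v : (off U v == 0) = (v \in U).
Proof.
rewrite offE subr_eq0; apply/eqP/idP => [->|/projv_id//].
exact: memv_proj.
Qed.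

(** The matrix of [off U] plays the role of [Q] in [expmx_stable]: stability of [U] says that
    [off U] after [f] depends only on [off U] of the argument. *)
Lemma expend_mem f (U : {vspace g}) (t : R) v :
  (forall u, u \in U -> f u \in U) -> v \in U -> expend (t *: f) v \in U.
Proof.
move=> fU vU; rewrite -off_eq0; apply/eqP/coords_inj; rewrite coords0 coords_app.
have FQ : mxend f *m mxend (off U) = mxend (off U) *m (mxend f *m mxend (off U)).
  rewrite -[LHS]mul1mx -[RHS]mul1mx; apply/row_matrixP => i; rewrite !row_mul.
  set w := row i _; have -> : w = coords (passmx.vecof (vbasis {:g}) w).
    by rewrite /coords passmx.vecofK.
  rewrite !mulmxA -!coords_app; congr coords; set u := passmx.vecof _ _.
  apply/eqP; rewrite -subr_eq0 -!linearB off_eq0 fU// offE opprB addrC subrK.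
  exact: memv_proj.
rewrite coords_expend; apply: expmx_stable => //.
by rewrite -coords_app; move: vU; rewrite -off_eq0 => /eqP ->; rewrite coords0.
Qed.

Lemma expend_derivative_mem f (U : {vspace g}) v :
  (forall t : R, expend (t *: f) v \in U) -> f v \in U.
Proof.
move=> vU; rewrite -off_eq0; apply/eqP/coords_inj; rewrite coords0 !coords_app.
apply: expmx_orbit_derivative => t; rewrite -coords_expend -coords_app.
by have := vU t; rewrite -off_eq0 => /eqP ->; rewrite coords0.
Qed.

Section ExpDerivation.
Variable br : {bilinear g -> g -> g}.

Definition derivation d := forall x y, d (br x y) = br (d x) y + br x (d y).

Let B k : 'M[R]_n :=
  \matrix_(i, j) coords (br (vbasis {:g})`_i (vbasis {:g})`_j) 0 k.

Let BE x y k : coords (br x y) 0 k = (coords x *m B k *m (coords y)^T) 0 0.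
Proof.
rewrite {1}[x](coord_basis basis) ?memvf// {1}[y](coord_basis basis) ?memvf//.
rewrite linear_sumlz /= /coords linear_sum summxE /= mxE.
under [RHS]eq_bigr do rewrite mxE mulr_suml.
rewrite exchange_big; apply: eq_bigr => i _ /=.
rewrite linear_sumr linear_sum summxE /=; apply: eq_bigr => j _.
rewrite linearZl_LR linearZr_LR /= !linearZ /= !mxE.
by rewrite mulrAC mulrA.
Qed.

Lemma exp_derivation d (t : R) x y : derivation d ->
  expend (t *: d) (br x y) = br (expend (t *: d) x) (expend (t *: d) y).
Proof.
move=> der; apply/esym/coords_inj; rewrite coords_expend.
apply/rowP => k; rewrite BE !coords_expend expmx_bilinear.
  by rewrite [RHS]mxE; apply: eq_bigr => l _; rewrite BE.
move=> {}x {}y {}k; pose X := passmx.vecof (vbasis {:g}) x.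
pose Y := passmx.vecof (vbasis {:g}) y.
have -> : x = coords X by rewrite /coords passmx.vecofK.
have -> : y = coords Y by rewrite /coords passmx.vecofK.
rewrite -!coords_app mxE -!BE.
have -> : coords (br (d X) Y) 0 k + coords (br X (d Y)) 0 k = coords (d (br X Y)) 0 k.
  by rewrite der coordsD [RHS]mxE.
by rewrite coords_app mxE; apply: eq_bigr => l _; rewrite -BE.
Qed.

Lemma exp_derivation_Aut d (t : R) : derivation d -> Aut br (expend (t *: d)).
Proof.
move=> der; split; last by move=> x y; apply: exp_derivation.
apply/eqP/lker0P => u v uv.
exact: etrans (esym (expendK d t u)) (etrans (congr1 _ uv) (expendK d t v)).
Qed.
End ExpDerivation.
End Coordinates.

Section LieBasics.
Variables (R : realType) (g : vectType R) (br : {bilinear g -> g -> g}).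
Hypothesis br_lie : lie_bracket br.
Implicit Types (x y z u v : g) (d : 'End(g)).
Local Notation ad := (ad br).

Lemma adE x y : ad x y = br x y. Proof. by rewrite lfunE. Qed.

Lemma brC x y : br x y = - br y x.
Proof.
have := lie_alt br_lie (x + y).
rewrite linearDl /= !linearDr /= !(lie_alt br_lie) add0r addr0 => /eqP.
by rewrite addr_eq0 => /eqP.
Qed.

Lemma adZ (t : R) x : ad (t *: x) = t *: ad x.
Proof. by apply/lfunP => y; rewrite scale_lfunE !adE linearZl_LR. Qed.

Lemma ad_derivation x : derivation br (ad x).
Proof.
move=> y z; rewrite !adE; have := lie_jacobi br_lie x y z.
rewrite (brC z x) linearNr /= (brC z (br x y)) -addrA -opprD => /eqP.
by rewrite subr_eq0 addrC => /eqP.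
Qed.

(** It is applied with [chi] the identity (semisimple part), complex conjugation and the real part.
    The points [ext] and the extra order [m] prescribe [f] further, even off the spectrum. *)
Lemma chi_part d (chi : R[i] -> R[i]) (ext : seq R[i]) (m : nat) : derivation br d ->
  (forall c, chi (conjc c) = conjc (chi c)) ->
  (forall a b, chi (a + b) = chi a + chi b) ->
  exists s K (f : {poly R}),
  [/\ uniq s, mapC (char_poly (mxend d)) %| primes_at s K,
    forall a, a \in s ++ ext -> ('X - a%:P) ^+ (K + m) %| mapC f - (chi a)%:P &
    forall u v, pact d f (br u v) = br (pact d f u) v + br u (pact d f v)].
Proof.
move=> der chiJ chiD.
have cp0 : char_poly (mxend d) != 0 by rewrite monic_neq0 ?char_poly_monic.
have [s [K [us sK]]] := spectrum cp0.
have [f fP] := real_crt (s ++ [seq a + b | a <- s, b <- s] ++ ext) (K + K + m) chiJ.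
exists s, K, f; split=> // [a|].
  rewrite mem_cat => aP; apply: dvdp_trans (fP a _).
    by rewrite dvdp_exp2l// leq_add2r leq_addr.
  by rewrite !mem_cat; case/orP: aP => ->; rewrite ?orbT.
apply: (chi_derivation _ _ _ _ _ us _ chiD) => //.
- by move=> u u' v; rewrite linearDl.
- by move=> u v v'; rewrite linearDr.
- by move=> c u v; rewrite linearZl_LR.
- by move=> c u v; rewrite linearZr_LR.
- move=> x; apply: pact_dvdp sK _; rewrite pact_cmap.
  by congr (_, _); apply: coords_inj; rewrite coords_pact polymx_char_poly mulmx0 coords0.
- move=> a aP; apply: dvdp_trans (fP a _); first by rewrite dvdp_exp2l// leq_addr.
  by move: aP; rewrite !mem_cat => /orP[]->; rewrite ?orbT.
Qed.

Lemma mxend_hommx (M : 'M[R]_(\dim {:g})) :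
  mxend (hommx (vbasis {:g}) (vbasis {:g}) M) = M.
Proof. exact: hommxK (vbasisP _) (vbasisP _) _. Qed.

Lemma coords_iter d k v : coords (iter k d v) = coords v *m mxend d ^+ k.
Proof.
elim: k => [|k IHk] /=; first by rewrite expr0 mulmx1.
by rewrite coords_app IHk exprSr -mulmxE mulmxA.
Qed.

(** [N] is [ad x - f(ad x)], with [f(ad x)] the semisimple part. It is a derivation, so [exp(tN)] is
    an automorphism. *)
Lemma nilpotent_part x m : exists N : 'End(g),
  [/\ nilpotent_end N, lie_of (zariski_closure (Aut br) (Inn br)) N &
      forall v, iter m (ad x) v = 0 -> N v = br x v].
Proof.
have [||s [K [f [us sK fP fder]]]] :=
  @chi_part (ad x) id [:: 0] m (@ad_derivation x) => //.
pose A := mxend (ad x).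
exists (hommx (vbasis {:g}) (vbasis {:g}) (A - polymx f A)); set N := hommx _ _ _.
have mxN : mxend N = A - polymx f A by exact: mxend_hommx.
have NE v : N v = ad x v - pact (ad x) f v.
  apply: coords_inj; rewrite coords_app mxN mulmxBr -coords_app -coords_pact.
  by rewrite /coords linearB.
have Nder : derivation br N.
  move=> u v; rewrite !NE fder ad_derivation linearBl linearBr /=.
  by rewrite opprD addrACA.
have [||NK Nvan] := @zariski_nilpotent_part _ _ A s K f us.
- have -> : polymx (primes_at s K) (map_mx (real_complex R) A) = 0 => //.
  case/dvdpP: sK => q ->; rewrite polymxM -map_polymx polymx_char_poly.
  by rewrite map_mx0 mulmx0.
- move=> a as_; apply: dvdp_trans (fP a _).
    by rewrite dvdp_exp2l// leq_addr.
  by rewrite mem_cat as_.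
split.
- exists K => v; apply: coords_inj.
  by rewrite coords_iter mxN NK mulmx0 coords0.
- move=> t; split; first exact: exp_derivation_Aut.
  move=> p p0; rewrite /polyfun mxend_expend mxendZ mxN.
  (* A polynomial vanishing on [Inn] vanishes at [exp(r ad x) = exp(ad(r x))]. *)
  apply: Nvan => r; rewrite -mxendZ -adZ -mxend_expend.
  exact: p0 (Inn_exp _ _).
- move=> v xv; rewrite NE adE -[RHS]subr0; congr (_ - _).
  (* The point 0 was put into [ext] with order at least [m], so that [f(ad x)] vanishes wherever the
     [m]-th power of [ad x] does. *)
  have fX : 'X^m %| f.
    rewrite -(dvdp_map (real_complex R)) rmorphXn /= map_polyX.
    have := fP 0; rewrite mem_cat inE eqxx orbT subr0 => /(_ isT).
    rewrite !polyC0 !subr0; apply: dvdp_trans.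
    by rewrite dvdp_exp2l// leq_addl.
  by apply: pact_dvdp fX _; rewrite pactXn.
Qed.

End LieBasics.

(** * The radical *)

Section FittingDecomposition.
Variables (R : realType) (g : vectType R) (d : 'End(g)).

(** The characteristic polynomial is [q X^m] with [q(0)] nonzero. Coprimality of [q] with [X^m]
    splits the space into the kernel and the image of [d^m]; coprimality with [X^k] shows that [d^k]
    maps this image onto itself. *)
Lemma fitting : exists m, (forall v, exists v0 w, v = v0 + iter m d w /\ iter m d v0 = 0)
  /\ (forall k w, exists w', iter m d w = iter (m + k) d w').
Proof.
have cp0 : char_poly (mxend d) != 0 by rewrite monic_neq0 ?char_poly_monic.
have [m [q]] := multiplicity_XsubC (char_poly (mxend d)) 0.
rewrite cp0 polyC0 subr0 /= => q0 cpE.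
have kill v : pact d (q * 'X^m) v = 0.
  by apply: coords_inj; rewrite coords_pact -cpE polymx_char_poly mulmx0 coords0.
have bezout k : exists u v, u * 'X^k + v * q = 1.
  have : coprimep 'X^k q.
    by rewrite coprimep_expl// -['X]subr0 -polyC0 coprimep_sym coprimep_XsubC.
  by move/Bezout_eq1_coprimepP => [[u v] /= e]; exists u, v.
exists m; split=> [v|k w].
  have [a [b ab]] := bezout m; exists (pact d (b * q) v), (pact d a v).
  rewrite -!pactXn -!pactM; split; last first.
    by rewrite mulrCA ['X^m * q]mulrC pactM kill linear0.
  by rewrite -pactD addrC [_ * a]mulrC ab pact1.
have [a [b ab]] := bezout k; exists (pact d a w).
rewrite -!pactXn -pactM exprD.
rewrite (_ : pact d 'X^m w = pact d (a * 'X^k * 'X^m) w).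
  by congr (pact d _ w); ring.
rewrite -['X^m in LHS]mul1r -ab mulrDl pactD -(mulrA b) (pactM d b) kill linear0.
exact: addr0.
Qed.

Variable br : {bilinear g -> g -> g}.

(** Write [[d u, z] = d [u, z] - [u, d z]]. The first term is covered by the inner induction on [a],
    the second by the outer one on [j], since [d z] is killed one step earlier. *)
Lemma fitting_bracket a j y z : derivation br d -> iter j d z = 0 ->
  exists w, br (iter (a + j) d y) z = iter a d w.
Proof.
move=> der; elim: j a y z => [|j IHj] a y z zj.
  by exists 0; rewrite /= in zj; rewrite zj linear0r iter_lin0.
elim: a => [|a [w wE]]; first by exists (br (iter j.+1 d y) z).
have [w' w'E] : exists w', br (iter (a.+1 + j) d y) (d z) = iter a.+1 d w'.
  by apply: IHj; rewrite -iterSr.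
exists (w - w'); have iterB k u v : iter k d (u - v) = iter k d u - iter k d v.
  by elim: k => //= k ->; rewrite linearB.
rewrite iterB -w'E iterS -wE der -(addSnnS a j) addrK.
by rewrite addnS iterS.
Qed.

End FittingDecomposition.

Section BracketSpace.
Variables (R : realType) (g : vectType R) (br : {bilinear g -> g -> g}).
Implicit Types (U V W : {vspace g}).

Lemma mem_brspace U V x y : x \in U -> y \in V -> br x y \in brspace br U V.
Proof.
move=> xU yV; rewrite (coord_vbasis xU) (coord_vbasis yV).
rewrite linear_sumlz; apply: memv_suml => i _ /=.
rewrite linear_sumr; apply: memv_suml => j _ /=.
rewrite linearZl_LR linearZr_LR /=; do 2 apply: memvZ.
by apply/memv_span/allpairs_f; apply: mem_nth; rewrite size_tuple.
Qed.

Lemma brspace_sub U V W : (forall x y, x \in U -> y \in V -> br x y \in W) ->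
  (brspace br U V <= W)%VS.
Proof.
move=> UVW; apply/span_subvP => _ /allpairsP[[x y] /= [xU yV ->]].
by apply: UVW; apply: vbasis_mem.
Qed.

Hypothesis br_lie : lie_bracket br.

Lemma brspace_ideal U V z : (forall u, u \in U -> br z u \in U) ->
  (forall v, v \in V -> br z v \in V) ->
  forall w, w \in brspace br U V -> br z w \in brspace br U V.
Proof.
move=> zU zV w; rewrite -adE memv_preim; apply/subvP/brspace_sub => x y xU yV.
rewrite -memv_preim (ad_derivation br_lie) !adE.
by apply: memvD; apply: mem_brspace; auto.
Qed.

Lemma derived_series_ideal U z i : (forall u, u \in U -> br z u \in U) ->
  forall u, u \in derived_series br U i -> br z u \in derived_series br U i.
Proof.
by move=> zU; elim: i => [|i IHi] //=; apply: brspace_ideal.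
Qed.

End BracketSpace.

Section NilInvariant.
Variables (R : realType) (g : vectType R) (br : {bilinear g -> g -> g}).
Hypothesis br_lie : lie_bracket br.
Variable form : {symmetric g}.
Hypothesis form_nil : nil_invariant br form.
Local Notation ad := (ad br).

Definition skew_ad x := forall y z, form (br x y) z = - form y (br x z).

Lemma form_sym u v : form u v = form v u.
Proof. by rewrite hermC expr0 mul1r. Qed.

Lemma skew_adD x y : skew_ad x -> skew_ad y -> skew_ad (x + y).
Proof.
by move=> sx sy u v; rewrite !(linearDl, linearDr) /= sx sy opprD.
Qed.

Lemma skew_adZ (a : R) x : skew_ad x -> skew_ad (a *: x).
Proof.
move=> sx u v; rewrite !linearZl_LR /= sx mulrN.
by rewrite linearZr_LR.
Qed.

Lemma skew_ad0 : skew_ad 0.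
Proof. by move=> u v; rewrite !(linear0l, linear0r) oppr0. Qed.

(** If [(ad x)^m = 0], then [N] agrees with [ad x] everywhere. *)
Lemma skew_ad_nilpotent x : nilpotent_end (ad x) -> skew_ad x.
Proof.
move=> [m xm]; have [N [Nnil Nlie NE]] := nilpotent_part br_lie x m.
by move=> u v; rewrite -!NE// (form_nil Nlie).
Qed.

Lemma skew_ad_pair x y z : skew_ad y -> skew_ad z ->
  form (br x y) z = - form y (br x z).
Proof.
move=> sy sz; rewrite (brC br_lie x y) (brC br_lie x z) linearNl linearNr opprK /=.
rewrite sy opprK -[form y _]opprK -sz (brC br_lie z y) linearNl /= opprK.
exact: form_sym.
Qed.

(* With respect to the Fitting decomposition [g0 + g1] of [ad x], the hypothesis
   makes [ad] skew on [g1], whence [<x, g1> = 0] and then [<g1, g0> = 0]; on [g0]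
   the operator [ad x] agrees with its nilpotent part. *)
Lemma skew_ad_fitting x : (forall y, skew_ad (br x (br x y))) -> skew_ad x.
Proof.
move=> sxx; have [m [dec surj]] := fitting (ad x).
have [N [Nnil Nlie NE]] := nilpotent_part br_lie x m.
have s1 w : skew_ad (iter m (ad x) w).
  by have [w' ->] := surj 2 w; rewrite addn2 !iterS !adE.
have surj1 w : exists w', iter m (ad x) w = br x (iter m (ad x) w').
  by have [w' ->] := surj 1 w; exists w'; rewrite addn1 iterS adE.
(* Write the vector as [u = [x, u']] with [u'] in [g1]. Skewness of [ad u'] on the pair [x, x] gives
   [2 <x, u> = 0]. *)
have x1 w : form x (iter m (ad x) w) = 0.
  have [w' e] := surj1 w; have := s1 w' x x.
  rewrite (brC br_lie _ x) -e linearNl linearNr opprK /= (form_sym _ x) => /eqP.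
  by rewrite eq_sym -addr_eq0 -mulr2n mulrn_eq0 => /eqP.
(* Here [<[x, u'], z> = <x, [u', z]>], and [[u', z]] lies in [g1] by [fitting_bracket]. *)
have g10 w z : iter m (ad x) z = 0 -> form (iter m (ad x) w) z = 0.
  move=> z0; have [w' ->] := surj1 w; rewrite (brC br_lie) linearNl /= s1 opprK.
  have [w2 ->] := surj m w'.
  have [w3 ->] := @fitting_bracket _ _ (ad x) br m m w2 z (ad_derivation br_lie x) z0.
  exact: x1.
have br0 z : iter m (ad x) z = 0 -> iter m (ad x) (br x z) = 0.
  by move=> z0; rewrite -adE -iterSr iterS z0 linear0.
have br1 w : br x (iter m (ad x) w) = iter m (ad x) (br x w).
  by rewrite -!adE -iterS iterSr.
move=> y z; have [y0 [y1 [-> y00]]] := dec y; have [z0 [z1 [-> z00]]] := dec z.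
set Y := iter m _ y1; set Z := iter m _ z1.
have e00 : form (br x y0) z0 = - form y0 (br x z0).
  by rewrite -(NE y0 y00) -(NE z0 z00) (form_nil Nlie Nnil).
have e10 : form (br x Y) z0 = - form Y (br x z0).
  by rewrite br1 !g10 ?oppr0// br0.
have e01 : form (br x y0) Z = - form y0 (br x Z).
  by rewrite (form_sym _ Z) (form_sym y0) br1 !g10 ?oppr0// br0.
have e11 : form (br x Y) Z = - form Y (br x Z).
  by apply: skew_ad_pair; [exact: s1 y1 | exact: s1 z1].
rewrite [br x (y0 + Y)]linearDr [br x (z0 + Z)]linearDr /=.
rewrite !linearDl !linearDr /= e00 e01 e10 e11 -!opprD.
by congr (- _); apply: addrACA.
Qed.

Lemma solvable_ideal_skew r : ideal_of br fullv r -> solvable_alg br r ->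
  forall x, x \in r -> skew_ad x.
Proof.
move=> [_ rI] [k rk].
have rI' z u : u \in r -> br z u \in r by apply: rI; rewrite memvf.
suff: forall j, (j <= k)%N -> forall x, x \in derived_series br r (k - j) -> skew_ad x.
  by move=> /(_ k (leqnn k)); rewrite subnn.
elim=> [_ x|j IHj ltjk x xr].
  by rewrite subn0 rk memv0 => /eqP ->; apply: skew_ad0.
(* Each derived term is an ideal of [g], so both [x] and [[x, y]] lie in the current term and their
   bracket in the next one. *)
apply: skew_ad_fitting => y; apply: (IHj (ltnW ltjk)); rewrite -(subnSK ltjk) /=.
apply: mem_brspace => //; rewrite (brC br_lie) memvN.
by apply: derived_series_ideal => //; apply: rI'.
Qed.

End NilInvariant.

(** * Traces and eigenvalues *)

Section TriangularMatrices.
Variables (F : fieldType) (n : nat).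
Implicit Types A B : 'M[F]_n.

Lemma mul_trig A B : is_trig_mx A -> is_trig_mx B -> is_trig_mx (A *m B).
Proof.
move=> /is_trig_mxP tA /is_trig_mxP tB; apply/is_trig_mxP => i j ij.
rewrite mxE big1// => k _; have [ik|ki] := ltnP i k; first by rewrite tA ?mul0r.
by rewrite tB ?mulr0// (leq_ltn_trans ki).
Qed.

Lemma mul_trig_diag A B i : is_trig_mx A -> is_trig_mx B ->
  (A *m B) i i = A i i * B i i.
Proof.
move=> /is_trig_mxP tA /is_trig_mxP tB; rewrite mxE (bigD1 i)//= big1 ?addr0// => k.
by rewrite neq_ltn => /orP[ki|ik]; [rewrite tB ?mulr0 | rewrite tA ?mul0r].
Qed.

Lemma polymx_trig A (f : {poly F}) : is_trig_mx A ->
  is_trig_mx (polymx f A) /\ forall i, polymx f A i i = f.[A i i].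
Proof.
move=> tA; have tX k : is_trig_mx (A ^+ k) /\ forall i, (A ^+ k) i i = A i i ^+ k.
  elim: k => [|k [tk dk]].
    by rewrite expr0 scalar_mx_is_trig; split=> // i; rewrite expr0 mxE eqxx.
  rewrite exprS -mulmxE mul_trig//; split=> // i.
  by rewrite mul_trig_diag// dk exprS.
split=> [|i]; last first.
  rewrite horner_coef /polymx summxE; apply: eq_bigr => k _.
  by rewrite mxE (tX k).2.
apply/is_trig_mxP => i j ij; rewrite /polymx summxE big1// => k _.
by rewrite mxE (is_trig_mxP (tX k).1) ?mulr0.
Qed.

Lemma polymx_conj (P : 'M[F]_n) A (f : {poly F}) : P \in unitmx ->
  polymx f (P *m A *m invmx P) = P *m polymx f A *m invmx P.
Proof.
move=> uP; rewrite /polymx mulmx_sumr mulmx_suml; apply: eq_bigr => i _.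
rewrite -scalemxAr -scalemxAl; congr (_ *: _).
elim: (i : nat) => [|k IHk]; first by rewrite !expr0 mulmx1 mulmxV.
by rewrite !exprS -!mulmxE IHk !mulmxA mulmxKV.
Qed.

Lemma polymxXn A k : polymx 'X^k A = A ^+ k.
Proof.
rewrite polymx_pact pactXn.
by elim: k => [//|k IHk]; rewrite iterS IHk exprS -mulmxE.
Qed.

End TriangularMatrices.

(** The numbers [d i] are the diagonal entries of a Schur triangular form over [R[i]]. If they
    vanish, the characteristic polynomial is [X^n] and Cayley-Hamilton applies. *)
Lemma complex_spectrum (R : rcfType) n (T : 'M[R]_n) :
  exists d : 'I_n -> R[i],
  [/\ forall f : {poly R}, (\tr (polymx f T))%:C%C = \sum_i (mapC f).[d i],
      forall f : {poly R}, (\det (polymx f T))%:C%C = \prod_i (mapC f).[d i] &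
      (forall i, d i = 0) -> T ^+ n = 0].
Proof.
case: n T => [|n] T.
  exists (fun=> 0); split=> [f|f|_].
  - by rewrite /mxtrace !big_ord0.
  - by rewrite det_mx00 big_ord0.
  - exact: flatmx0.
pose TC := map_mx (real_complex R) T.
have [P uP] := @Schur _ n.+1 TC isT; have {}uP := unitarymx_unit uP.
rewrite /similar_to /= conjumx// => tD; set D := P *m TC *m _ in tD.
have polyD f : polymx f D = P *m polymx f TC *m invmx P by exact: polymx_conj.
have polyT (f : {poly R}) :
    map_mx (real_complex R) (polymx f T) = invmx P *m polymx (mapC f) D *m P.
  by rewrite polyD !mulmxA mulVmx// mul1mx mulmxKV// map_polymx.
exists (fun i => D i i); split=> [f|f|d0].
- rewrite -[LHS]/(real_complex R _) -trace_map_mx polyT mxtrace_mulC mulmxA mulmxV// mul1mx.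
  by apply: eq_bigr => i _; rewrite (polymx_trig _ tD).2.
- rewrite -[LHS]/(real_complex R _) -det_map_mx polyT !det_mulmx mulrAC -det_mulmx.
  rewrite mulVmx// det1 mul1r det_trig; last exact: (polymx_trig _ tD).1.
  by apply: eq_bigr => i _; rewrite (polymx_trig _ tD).2.
- have Dn : polymx 'X^(n.+1) D = 0.
    rewrite -(polymx_char_poly D) char_poly_trig//; congr (polymx _ D).
    by rewrite (eq_bigr (fun=> 'X)) ?prodr_const ?card_ord// => i _; rewrite d0 subr0.
  apply: (map_mx_inj (f := real_complex R)); rewrite map_mx0.
  by rewrite -polymxXn polyT map_polyXn Dn mulmx0 mul0mx.
Qed.

(** The trace of [T f(T)] is the sum of the squared moduli of the eigenvalues. *)
Lemma conj_trace_nilpotent (R : rcfType) n (T : 'M[R]_n) (d : 'I_n -> R[i]) (f : {poly R}) :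
  (forall f : {poly R}, (\tr (polymx f T))%:C%C = \sum_i (mapC f).[d i]) ->
  (forall i, (mapC f).[d i] = conjc (d i)) ->
  \tr (T *m polymx f T) = 0 -> forall i, d i = 0.
Proof.
move=> dtr fd tr0; have : \sum_i `|d i| ^+ 2 = 0.
  transitivity (\tr (polymx ('X * f) T))%:C%C; last first.
    by rewrite polymxM -['X]expr1 polymxXn tr0.
  rewrite dtr; apply: eq_bigr => i _.
  by rewrite rmorphM /= map_polyX hornerM hornerX fd sqr_normc.
move/eqP; rewrite psumr_eq0 => [/allP d0 i|i _]; last by rewrite exprn_ge0.
by have := d0 i (mem_index_enum i); rewrite /= sqrf_eq0 normr_eq0 => /eqP.
Qed.

(** Take a real [f] that interpolates conjugation on the spectrum; [T f(T)] is a combination of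
    positive powers of [T]. *)
Lemma power_trace_nilpotent (R : rcfType) n (T : 'M[R]_n) :
  (forall k, \tr (T ^+ k.+1) = 0) -> T ^+ n = 0.
Proof.
move=> tr0; have [d [dtr _ dn]] := complex_spectrum T; apply: dn.
have [f fP] := @real_crt R (@conjc R) [seq d i | i <- enum 'I_n] 1 (fun=> erefl).
apply: (conj_trace_nilpotent (f := f) dtr).
  move=> i; have /fP : d i \in [seq d i | i <- enum 'I_n] by rewrite map_f ?mem_enum.
  by rewrite expr1 dvdp_XsubCl rootE hornerD hornerN hornerC subr_eq0 => /eqP.
rewrite /polymx mulmx_sumr linear_sum big1// => k _ /=.
by rewrite -scalemxAr linearZ /= mulmxE -exprS tr0 mulr0.
Qed.

(** * Engel's theorem and Cartan's criterion *)

Lemma max_dim_vspace (R : realType) (g : vectType R) (P : {vspace g} -> Prop) U0 : P U0 ->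
  exists2 U, P U & forall V, P V -> (\dim V <= \dim U)%N.
Proof.
move=> PU0; pose Q n := `[< exists U, P U /\ \dim U = n >].
have exQ : exists n, Q n by exists (\dim U0); apply/asboolP; exists U0.
have bdQ n : Q n -> (n <= \dim {:g})%N.
  by move=> /asboolP[U [_ <-]]; apply/dimvS/subvf.
case: (ex_maxnP exQ bdQ) => _ /asboolP[U [PU <-]] maxU; exists U => // V PV.
by apply: maxU; apply/asboolP; exists V.
Qed.

Lemma span_ind (F : fieldType) (V : vectType F) (P : V -> Prop) (l : seq V) :
  P 0 -> (forall u v, P u -> P v -> P (u + v)) -> (forall a u, P u -> P (a *: u)) ->
  {in l, forall u, P u} -> {in << l >>%VS, forall u, P u}.
Proof.
move=> P0 PD PZ Pl u /(@coord_span _ _ _ (in_tuple l)) ->.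
by elim/big_ind: _ => // i _; apply/PZ/Pl/mem_nth.
Qed.

Section Engel.
Variables (R : realType) (g : vectType R) (br : {bilinear g -> g -> g}).
Hypothesis br_lie : lie_bracket br.
Implicit Types (U V W L H : {vspace g}) (x y z : g).
Local Notation ad := (ad br).

Definition nil_on W x := forall w, w \in W -> exists k, iter k (ad x) w = 0.

(** Engel's theorem for the action of [L] on the image of [V] modulo [U], stated with subspaces
    instead of a quotient: a nonzero class is killed by [L]. *)
Definition engel_prop L := forall U V,
  (forall x u, x \in L -> u \in U -> br x u \in U) ->
  (forall x v, x \in L -> v \in V -> br x v \in V) ->
  (forall x, x \in L -> nil_on V x) -> ~~ (V <= U)%VS ->
  exists v, [/\ v \in V, v \notin U & forall x, x \in L -> br x v \in U].

(** Take [H] maximal among proper subalgebras. Engel for [H] acting on [L / H] yields [y] outside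
    [H] with [[H, y]] in [H]; then [H + <[y]>] is a subalgebra, hence all of [L]. *)
Lemma subalgebra_codim1 L : subalgebra br L -> L != 0%VS ->
  (forall x, x \in L -> nil_on L x) ->
  (forall H, subalgebra br H -> (H <= L)%VS -> (\dim H < \dim L)%N -> engel_prop H) ->
  exists H y, [/\ subalgebra br H, (H <= L)%VS, (\dim H < \dim L)%N, y \in L &
    (forall x, x \in H -> br x y \in H) /\ L = (H + <[y]>)%VS].
Proof.
move=> subL L0 nilL engel.
pose P H := [/\ subalgebra br H, (H <= L)%VS & H != L].
have P0 : P 0%VS.
  split; rewrite ?sub0v// 1?eq_sym//.
  by move=> x y; rewrite !memv0 => /eqP -> _; rewrite linear0l eqxx.
have [H [subH HL neHL] maxH] := max_dim_vspace P0.
have dHL : (\dim H < \dim L)%N by rewrite ltn_neqAle dimvS// andbT dimv_leqif_eq.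
have [||||y [yL yH Hy]] := engel H subH HL dHL H L.
- by move=> x u; apply: subH.
- by move=> x v xH; apply: subL; apply: (subvP HL).
- by move=> x xH; apply: nilL; apply: (subvP HL).
- by apply: contra neHL => LH; rewrite eqEsubv HL.
exists H, y; split=> //; split=> //; apply/eqP/contraT => neH'.
have H'L : (H + <[y]> <= L)%VS by rewrite subv_add HL -memvE.
suff /maxH : P (H + <[y]>)%VS.
  rewrite leqNgt => /negP[]; rewrite ltn_neqAle dimvS ?addvSl// andbT.
  rewrite dimv_leqif_eq ?addvSl//; apply: contra yH => /eqP ->.
  by rewrite (subvP (addvSr _ _))// memv_line.
split; rewrite 1?eq_sym// => _ _ /memv_addP[a aH [_ /vlineP[c ->] ->]]
  /memv_addP[b bH [_ /vlineP[e ->] ->]].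
rewrite !(linearDl, linearDr) /= !(linearZl_LR, linearZr_LR) /=.
rewrite ?(lie_alt br_lie) !scaler0 addr0; apply/(subvP (addvSl _ _)).
rewrite !memvD// ?memvZ//; do ?[exact: subH | exact: Hy].
by rewrite (brC br_lie) memvN; exact: Hy.
Qed.

Lemma engel L : subalgebra br L -> (forall x, x \in L -> nil_on L x) -> engel_prop L.
Proof.
have [n] := ubnP (\dim L); elim: n L => // n IHn L; rewrite ltnS => dL subL.
move=> nilL U V LU LV nilV VU.
have [L0|L0] := eqVneq L 0%VS.
  have [v vV vU] := subvPn VU; exists v; split=> // x.
  by rewrite L0 memv0 => /eqP ->; rewrite linear0l mem0v.
have engelH H : subalgebra br H -> (H <= L)%VS -> (\dim H < \dim L)%N -> engel_prop H.
  move=> subH HL dH; apply: IHn => //; first exact: leq_trans dH dL.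
  by move=> x xH w wH; apply: (nilL x); apply: (subvP HL).
have [H [y [subH HL dH yL [Hy LE]]]] := subalgebra_codim1 subL L0 nilL engelH.
have [||||v [vV vU Hv]] := engelH H subH HL dH U V => //.
- by move=> x u xH; apply: LU; apply: (subvP HL).
- by move=> x u xH; apply: LV; apply: (subvP HL).
- by move=> x xH; apply: nilV; apply: (subvP HL).
(* Since [[H, y]] lies in [H], applying [ad y] preserves the vectors that [H] kills modulo [U]. The
   last iterate outside [U] is then killed by [y] too. *)
have vk k : iter k (ad y) v \in V /\ forall x, x \in H -> br x (iter k (ad y) v) \in U.
  elim: k => [|k [kV kU]] //=; rewrite adE; split; first exact: LV.
  move=> x xH; rewrite -[br x _]adE (ad_derivation br_lie) !adE memvD//.
    by apply: kU; apply: Hy.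
  by apply: LU => //; apply: kU.
have exk : exists k, iter k (ad y) v \in U.
  by have [k vk0] := nilV y yL v vV; exists k; rewrite vk0 mem0v.
case: (ex_minnP exk) => -[|k] kU mink; first by rewrite /= (negPf vU) in kU.
exists (iter k (ad y) v); split; first exact: (vk k).1.
  by apply/negP => /mink; rewrite ltnn.
move=> x; rewrite LE => /memv_addP[h hH [_ /vlineP[c ->] ->]].
rewrite linearDl linearZl_LR /= memvD ?memvZ//; first exact: (vk k).2.
by move: kU; rewrite iterS adE.
Qed.

(** With [L = H + <[y]>] and [[y, y] = 0], all brackets fall into [H]. *)
Lemma engel_derived L : subalgebra br L -> L != 0%VS ->
  (forall x, x \in L -> nil_on L x) -> (\dim (brspace br L L) < \dim L)%N.
Proof.
move=> subL L0 nilL.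
have engelH H : subalgebra br H -> (H <= L)%VS -> (\dim H < \dim L)%N -> engel_prop H.
  move=> subH HL _; apply: engel => //.
  by move=> x xH w wH; apply: (nilL x); apply: (subvP HL).
have [H [y [subH HL dH yL [Hy LE]]]] := subalgebra_codim1 subL L0 nilL engelH.
apply: leq_ltn_trans dH; apply/dimvS/brspace_sub => u v; rewrite LE.
move=> /memv_addP[a aH [_ /vlineP[c ->] ->]] /memv_addP[b bH [_ /vlineP[e ->] ->]].
rewrite !(linearDl, linearDr) /= !(linearZl_LR, linearZr_LR) /=.
rewrite (lie_alt br_lie) !scaler0 addr0.
rewrite !memvD// ?memvZ//; do ?[exact: subH | exact: Hy].
by rewrite (brC br_lie) memvN; exact: Hy.
Qed.

Lemma derived_subalgebra L : subalgebra br L ->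
  (brspace br L L <= L)%VS /\ subalgebra br (brspace br L L).
Proof.
move=> subL; have LL : (brspace br L L <= L)%VS by apply: brspace_sub => x y; apply: subL.
by split=> // x y xL yL; apply: mem_brspace; apply: (subvP LL).
Qed.

Lemma derived_seriesSr L k :
  derived_series br L k.+1 = derived_series br (brspace br L L) k.
Proof. exact: iterSr. Qed.

Lemma solvable_derived L : solvable_alg br (brspace br L L) -> solvable_alg br L.
Proof. by move=> [k Lk]; exists k.+1; rewrite derived_seriesSr. Qed.

Lemma engel_solvable L : subalgebra br L -> (forall x, x \in L -> nil_on L x) ->
  solvable_alg br L.
Proof.
have [n] := ubnP (\dim L); elim: n L => // n IHn L; rewrite ltnS => dL subL nilL.
have [L0|L0] := eqVneq L 0%VS; first by exists 0%N; rewrite /= L0.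
have [LL subLL] := derived_subalgebra subL.
apply/solvable_derived/IHn => //; first exact: leq_trans (engel_derived _ _ _) dL.
by move=> x xL w wL; apply: (nilL x); apply: (subvP LL).
Qed.

End Engel.

Section Killing.
Variables (R : realType) (g : vectType R) (br : {bilinear g -> g -> g}).
Hypothesis br_lie : lie_bracket br.
Implicit Types (x y z : g) (d : 'End(g)).
Local Notation ad := (ad br).
Local Notation adx x := (mxend (ad x)).

(** The Killing form of all of [g], as opposed to [killing br h] for a subalgebra. *)
Definition trform x y : R := \tr (adx x *m adx y).

Lemma mxend_ext (d : 'End(g)) (A : 'M[R]_(\dim {:g})) :
  (forall x, coords (d x) = coords x *m A) -> mxend d = A.
Proof.
move=> dA; rewrite -(mxend_hommx A); congr mxend; apply/lfunP => x.
by apply: coords_inj; rewrite dA coords_app mxend_hommx.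
Qed.

Lemma mxend_ad_derivation d x : derivation br d ->
  adx (d x) = adx x *m mxend d - mxend d *m adx x.
Proof.
move=> der; apply: mxend_ext => y.
rewrite mulmxBr !mulmxA -!coords_app /coords -linearB !adE; congr (passmx.rVof _ _).
by rewrite der addrK.
Qed.

Lemma mxend_ad_br x y : adx (br x y) = adx y *m adx x - adx x *m adx y.
Proof. by rewrite -adE; apply/mxend_ad_derivation/(ad_derivation br_lie). Qed.

Lemma mxend_adD x y : adx (x + y) = adx x + adx y.
Proof.
apply: mxend_ext => z; rewrite mulmxDr -!coords_app -coordsD !adE.
by rewrite linearDl.
Qed.

Lemma mxend_adZ (a : R) x : adx (a *: x) = a *: adx x.
Proof. by rewrite adZ mxendZ. Qed.

Lemma trform_sym x y : trform x y = trform y x.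
Proof. exact: mxtrace_mulC. Qed.

Lemma trform_inv x y z : trform (br x y) z = - trform y (br x z).
Proof.
rewrite /trform !mxend_ad_br; move: (adx x) (adx y) (adx z) => X Y Z.
rewrite mulmxBl mulmxBr raddfB [in RHS]raddfB /= opprB !mulmxA.
by have -> : \tr (X *m Y *m Z) = \tr (Y *m Z *m X) by rewrite -mulmxA mxtrace_mulC.
Qed.

Lemma nilpotent_adP x : adx x ^+ \dim {:g} = 0 -> nilpotent_end (ad x).
Proof.
move=> x0; exists (\dim {:g}) => y; apply: coords_inj.
by rewrite coords_iter x0 mulmx0 coords0.
Qed.

(* If [d y = a y] with [a <> 0], then [ad y] shifts the generalized eigenspaces
   of [d]; in terms of traces, [a tr((ad y)^k) = tr([d, ad y] (ad y)^(k-1)) = 0]. *)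
Lemma eigenvector_nilpotent d (a : R) y : derivation br d -> a != 0 ->
  d y = a *: y -> nilpotent_end (ad y).
Proof.
move=> der a0 dy; apply/nilpotent_adP/power_trace_nilpotent => k.
apply: (mulfI a0); rewrite mulr0 -mxtraceZ exprS -mulmxE scalemxAl -mxend_adZ -dy.
rewrite mxend_ad_derivation//; move: (adx y) (mxend d) => Y D.
rewrite mulmxBl raddfB /= -!mulmxA mxtrace_mulC -mulmxA.
have -> : Y ^+ k *m Y = Y *m Y ^+ k by rewrite mulmxE -exprSr exprS.
exact: subrr.
Qed.

Lemma chi_derivation_eval d (chi : R[i] -> R[i]) (ext : seq R[i]) : derivation br d ->
  (forall c, chi (conjc c) = conjc (chi c)) ->
  (forall a b, chi (a + b) = chi a + chi b) ->
  exists2 f : {poly R}, {in ext, forall a, (mapC f).[a] = chi a} &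
    forall u v, pact d f (br u v) = br (pact d f u) v + br u (pact d f v).
Proof.
move=> der chiJ chiD.
have [s [K [f [_ _ fP fder]]]] := chi_part ext 1 der chiJ chiD.
exists f => // a aext; have : 'X - a%:P %| mapC f - (chi a)%:P.
  apply: dvdp_trans (fP a _); last by rewrite mem_cat aext orbT.
  by rewrite addn1 exprS dvdp_mulr.
by rewrite dvdp_XsubCl rootE hornerD hornerN hornerC subr_eq0 => /eqP.
Qed.

(** Up to sign, [tr(ad [y, z] d)] is [tr(ad y ad (d z))], where [d z] is again in [I]. *)
Lemma trace_derived (I : {vspace g}) d : derivation br d ->
  (forall y, y \in I -> d y \in I) ->
  (forall y z, y \in I -> z \in I -> trform y z = 0) ->
  forall x, x \in brspace br I I -> \tr (adx x *m mxend d) = 0.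
Proof.
move=> der dI I0; apply: span_ind.
- have -> : adx 0 = 0.
    by apply: mxend_ext => y; rewrite mulmx0 adE linear0l coords0.
  by rewrite mul0mx mxtrace0.
- by move=> u v u0 v0; rewrite mxend_adD mulmxDl mxtraceD u0 v0 addr0.
- by move=> a u u0; rewrite mxend_adZ -scalemxAl mxtraceZ u0 mulr0.
move=> _ /allpairsP[[y z] /= [yI zI ->]].
have := I0 y (d z) (vbasis_mem yI) (dI _ (vbasis_mem zI)).
rewrite /trform mxend_ad_derivation// mxend_ad_br.
move: (adx y) (adx z) (mxend d) => Y Z D; rewrite mulmxBr mulmxBl !raddfB /=.
rewrite !mulmxA [\tr (Y *m D *m Z)]mxtrace_mulC !mulmxA => /eqP.
by rewrite subr_eq0 => /eqP ->; rewrite subrr.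
Qed.

(* Cartan's criterion: for [x] in [[I, I]] the derivation with eigenvalues
   conjugate to those of [ad x] preserves [I], so the trace of its product with
   [ad x], which is the sum of the squared moduli of the eigenvalues, vanishes. *)
Lemma cartan (I : {vspace g}) : subalgebra br I ->
  (forall y z, y \in I -> z \in I -> trform y z = 0) -> solvable_alg br I.
Proof.
move=> subI I0; have [II subII] := derived_subalgebra subI.
apply/solvable_derived/(engel_solvable br_lie subII) => x xII w _.
have xI := subvP II _ xII.
suff [k xk] : nilpotent_end (ad x) by exists k.
have [d [dtr _ dn]] := complex_spectrum (adx x).
apply: nilpotent_adP; apply: dn.
have [||f fd fder] := @chi_derivation_eval (ad x) (@conjc R)
  [seq d i | i <- enum 'I_(\dim {:g})] (ad_derivation br_lie x) => //.
  by move=> a b; rewrite rmorphD.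
apply: (conj_trace_nilpotent (f := f) dtr) => [i|].
  by apply: fd; rewrite map_f ?mem_enum.
have <- : mxend (linfun (pact (ad x) f)) = polymx f (adx x).
  by apply: mxend_ext => y; rewrite lfunE coords_pact.
apply: trace_derived I0 _ xII => [u v|y yI]; first by rewrite !lfunE /= fder.
rewrite lfunE /=; apply: (pact_stable (P := fun v => v \in I)) => //.
- exact: mem0v.
- by move=> u v; apply: memvD.
- by move=> c v; apply: memvZ.
- by move=> v vI; rewrite /= adE; apply: subI.
Qed.

End Killing.

(** * The semisimple part without compact factors *)

Section Orthogonal.
Variables (R : realType) (g : vectType R) (beta : g -> g -> R).
Hypothesis beta_linl : forall a x y v, beta (a *: x + y) v = a * beta x v + beta y v.
Hypothesis beta_linr : forall a x y v, beta v (a *: x + y) = a * beta v x + beta v y.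
Variables (S V : {vspace g}).

(** Pairing with a basis of [V] makes the orthogonal the kernel of a linear map into a space of
    dimension [\dim V], whence the bound in [dim_orth]. *)
Definition orth_coords x : 'rV[R]_(\dim V) := \row_i beta x (vbasis V)`_i.

Lemma orth_coords_is_linear : linear orth_coords.
Proof. by move=> a x y; apply/rowP => i; rewrite !mxE beta_linl. Qed.
HB.instance Definition _ := GRing.isSemilinear.Build R g 'rV[R]_(\dim V) _ orth_coords
  (GRing.semilinear_linear orth_coords_is_linear).

Definition orth : {vspace g} := (S :&: lker (linfun orth_coords))%VS.

Lemma mem_orth x : x \in orth <-> x \in S /\ forall v, v \in V -> beta x v = 0.
Proof.
rewrite memv_cap memv_ker lfunE /=; split=> [/andP[-> /eqP x0]|[-> x0] /=].
  split=> // v vV; rewrite (coord_vbasis vV).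
  have lin0 : beta x 0 = 0.
    apply: (@addrI _ (beta x 0)); have := beta_linr 1 0 0 x.
    by rewrite scaler0 addr0 mul1r addr0.
  elim/big_ind: _ => // [u w u0 w0|i _].
    by rewrite -[u]scale1r beta_linr u0 w0 mulr0 addr0.
  rewrite -[_ *: _]addr0 beta_linr lin0 addr0.
  by have := congr1 (fun M : 'rV_(\dim V) => M 0 i) x0; rewrite !mxE => ->; rewrite mulr0.
apply/eqP/rowP => i; rewrite !mxE x0// vbasis_mem// mem_nth ?size_tuple//.
Qed.

Lemma dim_orth : (\dim S <= \dim orth + \dim V)%N.
Proof.
rewrite -(limg_ker_dim (linfun orth_coords) S) leq_add2l.
apply: leq_trans (dimvS (subvf _)) _.
by rewrite dimvf /dim /= mul1n.
Qed.

End Orthogonal.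

Section NilpotentIdeal.
Variables (R : realType) (g : vectType R) (br : {bilinear g -> g -> g}).
Hypothesis br_lie : lie_bracket br.
Implicit Types (x y z : g) (s : {vspace g}).
Local Notation ad := (ad br).

(** The automorphism [exp(t ad z)] conjugates [ad y] into the operator in question. *)
Lemma nilpotent_expend z y (t : R) : nilpotent_end (ad y) ->
  nilpotent_end (ad (expend (t *: ad z) y)).
Proof.
move=> [k yk]; have der := ad_derivation br_lie z.
have iterE v : iter k (ad (expend (t *: ad z) y)) (expend (t *: ad z) v) =
    expend (t *: ad z) (iter k (ad y) v).
  by elim: k {yk} => [//|k IHk]; rewrite !iterS IHk !adE exp_derivation.
exists k => u; have := iterE (expend (t *: - ad z) u).
by rewrite expendVK => ->; rewrite yk; exact: linear0.
Qed.

(* The span of the ad-nilpotent elements of [s] is stable under [exp (t ad z)],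
   hence, differentiating at [t = 0], under [ad z]. *)
Lemma nilpotent_span s : subalgebra br s -> exists V : {vspace g},
  [/\ ideal_of br s V, forall y, y \in s -> nilpotent_end (ad y) -> y \in V &
    exists2 l, V = << l >>%VS & {in l, forall y, nilpotent_end (ad y)}].
Proof.
move=> sub_s; pose P (U : {vspace g}) := exists2 l : seq g, U = << l >>%VS &
  {in l, forall y, y \in s /\ nilpotent_end (ad y)}.
have P0 : P 0%VS by exists [::]; rewrite ?span_nil.
have [V [l Vl lP] maxV] := max_dim_vspace P0.
have nilV y : y \in s -> nilpotent_end (ad y) -> y \in V.
  (* By maximality of [V], adjoining [y] cannot raise the dimension. *)
  move=> ys yn; have PyV : P << y :: l >>%VS.
    by exists (y :: l) => // u; rewrite inE => /predU1P[->|/lP].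
  have VyV : (V <= << y :: l >>)%VS by rewrite Vl span_cons addvSr.
  have /eqP -> : V == << y :: l >>%VS by rewrite -(dimv_leqif_eq VyV) eqn_leq dimvS ?maxV.
  by rewrite memv_span// mem_head.
have Vs : (V <= s)%VS by rewrite Vl; apply/span_subvP => u /lP[].
exists V; split=> //; last by exists l => // y /lP[].
split=> // z v zs; rewrite Vl -Vl; move: v; rewrite {1}Vl; apply: span_ind.
- by rewrite linear0r mem0v.
- by move=> u v uV vV; rewrite linearDr /= memvD.
- by move=> a u uV; rewrite linearZr_LR /= memvZ.
move=> y /lP[ys yn]; rewrite -adE; apply: expend_derivative_mem => t.
apply: nilV; last exact: nilpotent_expend.
by apply: expend_mem => // u us; rewrite adE; apply: sub_s.
Qed.

End NilpotentIdeal.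

Section CompactFactor.
Variables (R : realType) (g : vectType R) (br : {bilinear g -> g -> g}).
Hypothesis br_lie : lie_bracket br.
Implicit Types (x y z : g).
Variable h : {vspace g}.
Hypothesis sub_h : subalgebra br h.
Local Notation ad := (ad br).
Local Notation m := (\dim h).

Definition hcoords v : 'rV[R]_m := \row_j coord (vbasis h) j v.
Definition hmx x : 'M[R]_m := \matrix_(i, j) coord (vbasis h) j (br x (vbasis h)`_i).

Lemma hcoords_inj v : v \in h -> hcoords v = 0 -> v = 0.
Proof.
move=> vh v0; rewrite (coord_vbasis vh) big1// => i _.
by have := congr1 (fun M : 'rV_m => M 0 i) v0; rewrite !mxE => ->; rewrite scale0r.
Qed.

Lemma hcoords_br x v : v \in h -> hcoords (br x v) = hcoords v *m hmx x.
Proof.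
move=> vh; apply/rowP => j; rewrite !mxE {1}(coord_vbasis vh).
rewrite linear_sumr linear_sum; apply: eq_bigr => i _ /=.
by rewrite linearZr_LR linearZ /= !mxE.
Qed.

Lemma iter_ad_mem x v k : x \in h -> v \in h -> iter k (ad x) v \in h.
Proof. by move=> xh vh; elim: k => //= k IHk; rewrite adE; apply: sub_h. Qed.

Lemma hcoords_iter x v k : x \in h -> v \in h ->
  hcoords (iter k (ad x) v) = hcoords v *m hmx x ^+ k.
Proof.
move=> xh vh; elim: k => [|k IHk]; first by rewrite expr0 mulmx1.
by rewrite iterS adE hcoords_br ?iter_ad_mem// IHk exprSr -mulmxE mulmxA.
Qed.

Lemma hcoords_pact x v f : x \in h -> v \in h ->
  hcoords (pact (ad x) f v) = hcoords v *m polymx f (hmx x).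
Proof.
move=> xh vh; rewrite /pact /polymx mulmx_sumr.
transitivity (\sum_(i < size f) f`_i *: hcoords (iter i (ad x) v)).
  apply/rowP => j; rewrite summxE !mxE linear_sum; apply: eq_bigr => i _.
  by rewrite linearZ !mxE.
by apply: eq_bigr => i _; rewrite hcoords_iter// -scalemxAr.
Qed.

Lemma pact_ad_mem x v f : x \in h -> v \in h -> pact (ad x) f v \in h.
Proof.
by move=> xh vh; apply: memv_suml => i _; rewrite memvZ// iter_ad_mem.
Qed.

Lemma hmx_br x y : x \in h -> y \in h -> hmx (br x y) = hmx y *m hmx x - hmx x *m hmx y.
Proof.
move=> xh yh; apply/row_matrixP => i; have bh : (vbasis h)`_i \in h.
  by apply: vbasis_mem; rewrite mem_nth ?size_tuple.
have rowE z A : row i (hmx z *m A) = hcoords (br z (vbasis h)`_i) *m A.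
  by rewrite row_mul; congr (_ *m _); apply/rowP => j; rewrite !mxE.
have brE : br (br x y) (vbasis h)`_i =
    br x (br y (vbasis h)`_i) - br y (br x (vbasis h)`_i).
  by have := ad_derivation br_lie x y (vbasis h)`_i; rewrite !adE => ->; rewrite addrK.
rewrite -[hmx (br x y)]mulmx1 rowE mulmx1 brE linearB /= !rowE.
rewrite -!hcoords_br ?sub_h//.
by apply/rowP => j; rewrite !mxE linearB.
Qed.

Lemma killingE x y : y \in h -> killing br h x y = \tr (hmx y *m hmx x).
Proof.
move=> yh; apply: eq_bigr => i _; have bh : (vbasis h)`_i \in h.
  by apply: vbasis_mem; rewrite mem_nth ?size_tuple.
have := congr1 (fun M : 'rV_m => M 0 i) (hcoords_br x (sub_h yh bh)).
by rewrite !mxE => ->; apply: eq_bigr => j _; rewrite !mxE.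
Qed.

Hypothesis radical_h : is_radical br h 0%VS.
Hypothesis no_nilpotent : forall y, y \in h -> nilpotent_end (ad y) -> y = 0.

(* Otherwise the derivation acting by the real parts of the eigenvalues of
   [ad x] has an eigenvector in [h] with nonzero real eigenvalue. *)
Lemma imaginary_spectrum x (d : 'I_m -> R[i]) : x \in h ->
  (forall f : {poly R}, (\det (polymx f (hmx x)))%:C%C = \prod_i (mapC f).[d i]) ->
  forall i, complex.Re (d i) = 0.
Proof.
move=> xh ddet i; set a := complex.Re _; apply/eqP/contraT => a0.
have [||f fd fder] := @chi_derivation_eval _ _ br (ad x)
    (fun c => (complex.Re c)%:C%C) [:: d i] (ad_derivation br_lie x).
- by move=> c; rewrite conjc_real; case: c.
- by move=> [b b'] [c c'] /=; rewrite rmorphD.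
(* The factor at [d i] is [a - a]. A kernel row gives the coordinates of an eigenvector [y] in
   [h]. *)
have : \det (polymx (f - a%:P) (hmx x)) == 0.
  apply/eqP/(@complexI R); rewrite rmorph0 ddet (bigD1 i)//= rmorphB /= map_polyC.
  by rewrite hornerD hornerN hornerC fd ?mem_head// subrr mul0r.
move=> /det0P[u u0 uf]; pose y := \sum_j u 0 j *: (vbasis h)`_j.
have yh : y \in h.
  by apply: memv_suml => j _; rewrite memvZ// vbasis_mem// mem_nth ?size_tuple.
have yu : hcoords y = u.
  apply/rowP => j; rewrite mxE coord_sum_free//.
  exact: basis_free (vbasisP h).
have fy : linfun (pact (ad x) f) y = a *: y.
  apply/eqP; rewrite lfunE /= -subr_eq0 -(pactC (ad x)) -pactB; apply/eqP.
  by apply: hcoords_inj; rewrite ?pact_ad_mem// hcoords_pact// yu.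
have y0 : y = 0.
  apply: no_nilpotent => //; apply: eigenvector_nilpotent a0 fy => // v w.
  by rewrite !lfunE /= fder.
by move: u0; rewrite -yu y0 /hcoords; case/eqP; apply/rowP => j; rewrite !mxE linear0.
Qed.

(** The eigenvalues of [ad x] on [h] are imaginary, so the sum of their squares is nonpositive, and
    zero only if all of them vanish. *)
Lemma killing_npos x : x \in h -> killing br h x x <= 0 /\
  (killing br h x x = 0 -> nil_on br h x).
Proof.
move=> xh; have [d [dtr ddet dn]] := complex_spectrum (hmx x).
have Re0 := imaginary_spectrum xh ddet.
have kE : killing br h x x = - \sum_i complex.Im (d i) ^+ 2.
  apply: (@complexI R); rewrite killingE// mulmxE -expr2 -polymxXn dtr.
  rewrite rmorphN rmorph_sum -sumrN; apply: eq_bigr => i _ /=.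
  rewrite map_polyXn hornerXn; move: (Re0 i); case: (d i) => b c /= ->.
  rewrite expr2; apply/eqP; rewrite eq_complex /= !mul0r !mulr0 addr0 sub0r -expr2.
  by rewrite !eqxx oppr0 eqxx.
split; first by rewrite kE oppr_le0 sumr_ge0// => i _; rewrite sqr_ge0.
rewrite kE => /eqP; rewrite oppr_eq0 psumr_eq0 => [/allP d0|i _]; last exact: sqr_ge0.
move=> w wh; exists m; apply: hcoords_inj; rewrite ?iter_ad_mem// hcoords_iter//.
rewrite dn ?mulmx0// => i; have := d0 i (mem_index_enum i).
rewrite /= sqrf_eq0 => /eqP; move: (Re0 i).
by case: (d i) => b c /= -> ->.
Qed.

Lemma killing_linl a x y v :
  killing br h (a *: x + y) v = a * killing br h x v + killing br h y v.
Proof.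
rewrite /killing mulr_sumr -big_split; apply: eq_bigr => i _ /=.
by rewrite linearPl linearP.
Qed.

Lemma killing_linr a x y v :
  killing br h v (a *: x + y) = a * killing br h v x + killing br h v y.
Proof.
rewrite /killing mulr_sumr -big_split; apply: eq_bigr => i _ /=.
by rewrite linearPl linearPr linearP.
Qed.

Lemma killing_sym x y : x \in h -> y \in h -> killing br h x y = killing br h y x.
Proof. by move=> xh yh; rewrite !killingE// mxtrace_mulC. Qed.

Lemma killing_inv x y z : x \in h -> y \in h -> z \in h ->
  killing br h (br x y) z = - killing br h y (br x z).
Proof.
move=> xh yh zh; rewrite !killingE// ?sub_h// !hmx_br//.
move: (hmx x) (hmx y) (hmx z) => X Y Z; rewrite mulmxBl mulmxBr raddfB [in RHS]raddfB /= opprB.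
rewrite !mulmxA; congr (_ - _).
by rewrite -[X *m Z *m Y]mulmxA [RHS]mxtrace_mulC.
Qed.

(** An isotropic vector of a semidefinite form lies in its kernel [n]. This is an ideal consisting
    of elements nilpotent on [h], hence solvable by Engel's theorem, hence zero. *)
Lemma compact_type_no_nilpotent : compact_type br h.
Proof.
split; first by split.
right=> x xh x0; have [Kx Kx0] := killing_npos xh.
rewrite lt_neqAle Kx andbT; apply: contra x0 => /eqP Kxx.
pose n := orth (killing br h) h h.
have nP y : y \in n <-> y \in h /\ forall v, v \in h -> killing br h y v = 0.
  exact: (mem_orth killing_linl killing_linr h h).
have n_ideal : ideal_of br h n.
  split; first by apply/subvP => y /nP[].
  move=> z y zh /nP[yh y0]; apply/nP; split; first exact: sub_h.
  by move=> v vh; rewrite killing_inv// y0 ?oppr0// sub_h.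
have n_solv : solvable_alg br n.
  have nh y : y \in n -> y \in h by case/nP.
  apply: (engel_solvable br_lie) => [y z yn zn|y yn w wn].
    by apply: n_ideal.2 => //; apply: nh.
  have [yh y0] := (nP y).1 yn.
  by apply: (killing_npos yh).2; [exact: y0 | exact: nh].
suff xn : x \in n by have := subvP (radical_max radical_h n_ideal n_solv) x xn; rewrite memv0.
apply/nP; split=> // v vh.
(* A semidefinite form vanishing at [x] is annihilated by [x]. *)
have pos t : t * (t * killing br h v v + killing br h x v * 2) <= 0.
  have := (killing_npos (memvD (memvZ t vh) xh)).1.
  rewrite killing_linl !killing_linr Kxx (killing_sym vh xh).
  by apply: le_trans; rewrite le_eqVlt; apply/orP; left; apply/eqP; ring.
have Kv := (killing_npos vh).1; apply/eqP/contraT => b0.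
have c1 : 0 < 1 - killing br h v v by lra.
(* For [t = b / (1 - c)], with [b] the value at [x, v] and [c <= 0] that at [v, v], the left side of
   [pos] is [t^2 (2 - c) > 0]. *)
have := pos (killing br h x v / (1 - killing br h v v)).
rewrite (_ : _ * _ = (killing br h x v / (1 - killing br h v v)) ^+ 2 *
  (2 - killing br h v v)); last by field; lra.
have t0 : 0 < (killing br h x v / (1 - killing br h v v)) ^+ 2.
  by rewrite exprn_even_gt0//= mulf_neq0// invr_neq0// gt_eqF.
have c2 : 0 < 2 - killing br h v v by lra.
by rewrite leNgt mulr_gt0.
Qed.

End CompactFactor.

Section Semisimple.
Variables (R : realType) (g : vectType R) (br : {bilinear g -> g -> g}).
Hypothesis br_lie : lie_bracket br.
Variables (s : {vspace g}).
Hypotheses (ss : semisimple br s) (sc : no_compact_factor br s).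
Local Notation ad := (ad br).

Lemma trform_linl a x y v : trform br (a *: x + y) v = a * trform br x v + trform br y v.
Proof. by rewrite /trform mxend_adD mxend_adZ mulmxDl -scalemxAl mxtraceD mxtraceZ. Qed.

Lemma trform_linr a x y v : trform br v (a *: x + y) = a * trform br v x + trform br v y.
Proof. by rewrite !(trform_sym _ v) trform_linl. Qed.

Lemma noncompact_nilpotent_span : exists2 l, s = << l >>%VS &
  {in l, forall y, nilpotent_end (ad y)}.
Proof.
have [sub_s rad_s] := ss.
have [V [[Vs Vid] nilV Vl]] := nilpotent_span br_lie sub_s.
have [h hP dim_h] : exists2 h : {vspace g}, forall y, y \in h <->
    y \in s /\ (forall v, v \in V -> trform br y v = 0) & (\dim s <= \dim h + \dim V)%N.
  exists (orth (trform br) s V); last exact: dim_orth.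
  exact: mem_orth (@trform_linl) (@trform_linr) s V.
have hs : (h <= s)%VS by apply/subvP => y /hP[].
have h_ideal : ideal_of br s h.
  split=> // z x zs /hP[xs x0]; apply/hP; split; first exact: sub_s.
  by move=> v vV; rewrite trform_inv// x0 ?oppr0//; apply: Vid.
have cap0 : (h :&: V)%VS = 0%VS.
  have cap_ideal : ideal_of br s (h :&: V)%VS.
    split; first by rewrite (subv_trans (capvSl _ _)).
    by move=> z x zs; rewrite !memv_cap => /andP[xh xV]; rewrite h_ideal.2// Vid.
  apply/eqP; rewrite -subv0; apply: (radical_max rad_s) => //.
  (* The trace form vanishes on the intersection because [h] is orthogonal to [V]. *)
  apply: (cartan br_lie) => [y z yc zc|y z].
    by apply: cap_ideal.2 => //; apply: (subvP cap_ideal.1).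
  by rewrite !memv_cap => /andP[/hP[_ y0] _] /andP[_ zV]; apply: y0.
have sum_s : (h + V)%VS = s.
  have le_s : (h + V <= s)%VS by rewrite subv_add hs.
  apply/eqP; rewrite -(dimv_leqif_eq le_s) eqn_leq dimvS//=.
  have := dimv_sum_cap h V; rewrite cap0 dimv0 addn0 => ->.
  exact: dim_h.
have sub_h : subalgebra br h by move=> x y xh yh; apply: h_ideal.2 => //; apply: (subvP hs).
have rad_h : is_radical br h 0%VS.
  split.
  - split; first exact: sub0v.
    by move=> x y _; rewrite memv0 => /eqP ->; rewrite linear0r mem0v.
  - by exists 0%N.
  move=> I [Ih Iid] Isolv; apply: (radical_max rad_s) => //.
  split; first exact: subv_trans hs.
  move=> z y; rewrite -{1}sum_s => /memv_addP[a ah [b bV ->]] yI.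
  have yh := subvP Ih y yI; rewrite linearDl /=; apply: memvD; first exact: Iid.
  (* Since [[V, h]] lies in the zero intersection, an ideal of [h] is an ideal of [s]. *)
  have : br b y \in (h :&: V)%VS.
    rewrite memv_cap h_ideal.2 ?(subvP Vs)//= (brC br_lie) memvN Vid//.
    exact: (subvP hs).
  by rewrite cap0 memv0 => /eqP ->; rewrite mem0v.
have h_nil y : y \in h -> nilpotent_end (ad y) -> y = 0.
  move=> yh yn; apply/eqP; rewrite -memv0 -cap0 memv_cap yh nilV//.
  exact: (subvP hs).
have h0 : h = 0%VS.
  apply: sc; last exact: compact_type_no_nilpotent.
  by exists V; split.
by rewrite -sum_s h0 add0v.
Qed.

End Semisimple.

Theorem theoremA (R : realType) (g : vectType R)
    (br : {bilinear g -> g -> g}) (br_lie : lie_bracket br)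
    (k s r : {vspace g}) (levi : levi_decomposition br k s r)
    (form : {symmetric g}) (form_nil : nil_invariant br form) :
  let gs := (s + r)%VS in
  (forall X Y Z : g, Y \in gs -> Z \in gs ->
     form (br X Y) Z = - form Y (br X Z)) /\
  (forall X Y Z : g, X \in gs ->
     form (br X Y) Z = - form Y (br X Z)).
Proof.
move=> gs; have [rad_r _ [ss sc] _ _ _] := levi.
have s_skew x : x \in s -> skew_ad br form x.
  have [l -> ln] := noncompact_nilpotent_span br_lie ss sc.
  apply: span_ind x; [exact: skew_ad0 | exact: skew_adD | exact: skew_adZ |].
  by move=> y /ln; apply: skew_ad_nilpotent.
have gs_skew x : x \in gs -> skew_ad br form x.
  move=> /memv_addP[a /s_skew sa [b br_ ->]]; apply: skew_adD => //.
  by apply: (solvable_ideal_skew br_lie form_nil rad_r.(radical_ideal)) br_; case: rad_r.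
split=> [X Y Z Ys Zs | X Y Z /gs_skew]; last exact.
by apply: skew_ad_pair => //; apply: gs_skew.
Qed.
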